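(* Let $\mathcal{C}$ be a category of noncrossing partitions, let $N\geq 4$ and let $\mathbb{G}$ be the associated easy quantum group. Then the representation $u_p$ is non-zero and irreducible for every projective partition $p\in\mathcal{C}$. In other words, there is a bijection $$\mathrm{Irr}(\mathbb{G})\simeq\Big(\bigcup_k\mathrm{Proj}_{\mathcal{C}}(k)\Big)/\sim$$ (given by $p\mapsto u_p$), where $\mathrm{Irr}(\mathbb{G})$ is the set of equivalence classes of irreducible representations of $\mathbb{G}$.
   Context: Partitions. For integers $k,l\ge 0$, $P(k,l)$ is the set of set-partitions (into blocks) of the disjoint union of $k$ upper points, labelled $1,\dots,k$ from left to right, and $l$ lower points, labelled $1',\dots,l'$. A partition is noncrossing if its blocks can be drawn by strings (between the two rows) without crossings. A through-block is a block containing both upper and lower points; $b(p)$ and $t(p)$ are the numbers of blocks and of through-blocks, and $\beta(p)=b(p)-t(p)$. Operations: $p\otimes q$ is horizontal concatenation; for $p\in P(k,l)$, $q\in P(l,m)$, the composition $qp\in P(k,m)$ is vertical concatenation ($p$ on top, $q$ below, the lower points of $p$ identified with the upper points of $q$, then the middle points removed); $p^{*}\in P(l,k)$ is $p$ turned upside down; a rotation moves the leftmost (or rightmost) point of one row to the leftmost (resp. rightmost) position of the other row, keeping the block structure. The identity partition $|\in P(1,1)$ has a single block. A partition $p\in P(k,k)$ is projective if $p=p^{*}=pp$. A category of partitions $\mathcal{C}$ is a collection of subsets $\mathcal{C}(k,l)\subseteq P(k,l)$ ($k,l\ge0$) closed under tensor product, composition (when defined), involution and rotation, with $|\in\mathcal{C}(1,1)$;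 it is a category of noncrossing partitions if all its elements are noncrossing. $\mathrm{Proj}_{\mathcal{C}}(k)$ is the set of projective partitions in $\mathcal{C}(k,k)$. For projective $p,q\in P(k,k)$, $q\preceq p$ means $pq=q$ (equivalently $qp=q$), and $q\prec p$ means $q\preceq p$, $q\ne p$. For $p\in\mathrm{Proj}_{\mathcal{C}}(k)$, $q\in\mathrm{Proj}_{\mathcal{C}}(l)$, $p\sim q$ means that there is $r\in\mathcal{C}(k,l)$ with $r^{*}r=p$ and $rr^{*}=q$. Linear maps. Let $e_1,\dots,e_N$ be the canonical basis of $\mathbb{C}^N$. For $p\in P(k,l)$, $\mathring{T}_p:(\mathbb{C}^N)^{\otimes k}\to(\mathbb{C}^N)^{\otimes l}$ is $\mathring{T}_p(e_{i_1}\otimes\cdots\otimes e_{i_k})=\sum_{j_1,\dots,j_l=1}^N\delta_p(i,j)\,e_{j_1}\otimes\cdots\otimes e_{j_l}$, where $\delta_p(i,j)=1$ if, after labelling the upper points by $i$ and the lower points by $j$, all points in a common block have equal labels, and $\delta_p(i,j)=0$ otherwise. Set $T_p=N^{-\beta(p)/2}\mathring{T}_p$ (for projective $p$, $T_p$ is an orthogonal projection). Easy quantum groups. The easy quantum group associated with $\mathcal{C}$ and $N$ is the unique compact matrix quantum group $\mathbb{G}$ ($S_N\subset\mathbb{G}\subset O_N^+$) with $N$-dimensional fundamental representation $u$ such that $\mathrm{Hom}(u^{\otimes k},u^{\otimes l})=\mathrm{Span}\{T_p: p\in\mathcal{C}(k,l)\}$ for all $k,l\ge0$. Representations $u_p$.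 For $p\in\mathrm{Proj}_{\mathcal{C}}(k)$ let $R_p=\bigvee_{q\in\mathrm{Proj}_{\mathcal{C}}(k),\,q\prec p}T_q$ (supremum among projections of the finite-dimensional von Neumann algebra $\mathrm{Hom}(u^{\otimes k},u^{\otimes k})$, $0$ if there is no such $q$), $P_p=T_p-R_p$, and $u_p=(\iota\otimes P_p)(u^{\otimes k})$, the subrepresentation of $u^{\otimes k}$ on the range of $P_p$, where $\iota$ is the identity of $C(\mathbb{G})$. *)

(* Defs.v *)
From mathcomp Require Import boolp classical_sets functions.
From mathcomp Require Import all_boot all_order all_algebra.

Set Implicit Arguments.
Unset Strict Implicit.
Unset Printing Implicit Defensive.

Import GRing.Theory Num.Theory.
Local Open Scope ring_scope.

(** * Partitions *)

Definition partn (T : finType) : Type :=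
  {p : {set {set T}} | partition p [set: T]%SET}.

Definition blocks (T : finType) (p : partn T) : {set {set T}} := val p.

Definition same_block (T : finType) (p : partn T) (x y : T) : bool :=
  pblock (blocks p) x == pblock (blocks p) y.

(* The partition of [T] into the nonempty fibres of [f]. *)
Definition fibre_partn (T : finType) (rT : eqType) (f : T -> rT) : partn T :=
  exist _ (preim_partition f [set: T]%SET) (preim_partitionP f [set: T]%SET).

Definition pullback_partn (S T : finType) (f : S -> T) (p : partn T) : partn S :=
  fibre_partn (fun x => pblock (blocks p) (f x)).

(* [inl i] is the upper point i+1, [inr j] is the lower point (j+1)'. *)
Notation points k l := ('I_k + 'I_l)%type.
Notation part k l := (partn (points k l)).

Section PartitionOperations.
Variables k l m k' l' : nat.

Definition id_part : part 1 1 := fibre_partn (fun _ => tt).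

Definition tensor_part (p : part k l) (q : part k' l') : part (k + k') (l + l') :=
  fibre_partn (fun x : points (k + k') (l + l') =>
    match x with
    | inl i => match split i with
               | inl i1 => inl (pblock (blocks p) (inl i1))
               | inr i2 => inr (pblock (blocks q) (inl i2))
               end
    | inr j => match split j with
               | inl j1 => inl (pblock (blocks p) (inr j1))
               | inr j2 => inr (pblock (blocks q) (inr j2))
               end
    end).

Definition swap_points (x : points l k) : points k l :=
  match x with inl j => inr j | inr i => inl i end.

Definition star_part (p : part k l) : part l k := pullback_partn swap_points p.

(* Vertical concatenation takes place on the upper points of [p], the middle
   points and the lower points of [q]. *)
Definition stack_of_top (x : points k l) : ('I_k + 'I_l) + 'I_m := inl x.
Definition stack_of_bottom (x : points l m) : ('I_k + 'I_l) + 'I_m :=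
  match x with inl j => inl (inr j) | inr i => inr i end.
Definition stack_outer (x : points k m) : ('I_k + 'I_l) + 'I_m :=
  match x with inl i => inl (inl i) | inr j => inr j end.

Definition stack_edge (p : part k l) (q : part l m) : rel (('I_k + 'I_l) + 'I_m) :=
  fun x y =>
    [exists a, exists b,
       [&& stack_of_top a == x, stack_of_top b == y & same_block p a b]]
 || [exists a, exists b,
       [&& stack_of_bottom a == x, stack_of_bottom b == y & same_block q a b]].

(* This is [qp]: [p] on top of [q]. *)
Definition comp_part (p : part k l) (q : part l m) : part k m :=
  fibre_partn (fun x =>
    [set y | connect (stack_edge p q) (stack_outer x) y]%SET).

End PartitionOperations.

(* Moving the upper point [h] of [part k.+1 l] to the lower position [h'], and
   the lower point [h'] of [part k l.+1] to the upper position [h]. *)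
Definition rot_down k l (h : 'I_k.+1) (h' : 'I_l.+1) (p : part k.+1 l) :
    part k l.+1 :=
  pullback_partn (fun x : points k l.+1 =>
    match x with
    | inl i => inl (lift h i)
    | inr j => if unlift h' j is Some j' then inr j' else inl h
    end) p.

Definition rot_up k l (h : 'I_k.+1) (h' : 'I_l.+1) (p : part k l.+1) :
    part k.+1 l :=
  pullback_partn (fun x : points k.+1 l =>
    match x with
    | inl i => if unlift h i is Some i' then inl i' else inr h'
    | inr j => inr (lift h' j)
    end) p.

(* Position on the boundary of the strip, read clockwise: the upper points
   from left to right, then the lower points from right to left. *)
Definition boundary_pos k l (x : points k l) : nat :=
  match x with inl i => i | inr j => k + (l - j.+1) end.

Definition noncrossing k l (p : part k l) : Prop :=
  forall a b c d : points k l,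
    (boundary_pos a < boundary_pos b)%N ->
    (boundary_pos b < boundary_pos c)%N ->
    (boundary_pos c < boundary_pos d)%N ->
    same_block p a c -> same_block p b d -> same_block p a b.

Definition is_through_block k l (B : {set points k l}) : bool :=
  [exists i, inl i \in B] && [exists j, inr j \in B].

Definition nb_blocks k l (p : part k l) : nat := #|blocks p|.
Definition nb_through k l (p : part k l) : nat :=
  #|[set B in blocks p | is_through_block B]%SET|.
Definition beta k l (p : part k l) : nat := (nb_blocks p - nb_through p)%N.

Definition part_family := forall k l : nat, {set part k l}.

Record is_category (C : part_family) : Prop := IsCategory {
  cat_id : id_part \in C 1%N 1%N;
  cat_tensor : forall k l k' l' (p : part k l) (q : part k' l'),
    p \in C k l -> q \in C k' l' -> tensor_part p q \in C (k + k')%N (l + l')%N;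
  cat_comp : forall k l m (p : part k l) (q : part l m),
    p \in C k l -> q \in C l m -> comp_part p q \in C k m;
  cat_star : forall k l (p : part k l), p \in C k l -> star_part p \in C l k;
  cat_rot_down_left : forall k l (p : part k.+1 l),
    p \in C k.+1 l -> rot_down ord0 ord0 p \in C k l.+1;
  cat_rot_down_right : forall k l (p : part k.+1 l),
    p \in C k.+1 l -> rot_down ord_max ord_max p \in C k l.+1;
  cat_rot_up_left : forall k l (p : part k l.+1),
    p \in C k l.+1 -> rot_up ord0 ord0 p \in C k.+1 l;
  cat_rot_up_right : forall k l (p : part k l.+1),
    p \in C k l.+1 -> rot_up ord_max ord_max p \in C k.+1 l
}.

Definition is_noncrossing_category (C : part_family) : Prop :=
  is_category C /\ forall k l (p : part k l), p \in C k l -> noncrossing p.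

Definition projective k (p : part k k) : bool :=
  (p == star_part p) && (p == comp_part p p).

Definition Proj (C : part_family) (k : nat) : {set part k k} :=
  [set p in C k k | projective p]%SET.

(* [q] is dominated by [p] when [pq = q]. *)
Definition dominated k (q p : part k k) : bool := comp_part q p == q.
Definition sdominated k (q p : part k k) : bool := dominated q p && (q != p).

Definition equiv_part (C : part_family) k l (p : part k k) (q : part l l) : Prop :=
  exists r : part k l,
    [/\ r \in C k l, comp_part r (star_part r) = p
      & comp_part (star_part r) r = q].

(** * The maps T_p *)

(* Indexes the basis e_{i_1} (x) ... (x) e_{i_k} of the k-th tensor power of
   K^N; a linear map is its matrix in these bases, acting on columns. *)
Notation multi_index N k := {ffun 'I_k -> 'I_N}.
Notation tdim N k := #|{: multi_index N k}|.

Section PartitionMaps.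
Variables (K : numClosedFieldType) (N : nat).

Definition label k l (i : multi_index N k) (j : multi_index N l)
    (x : points k l) : 'I_N :=
  match x with inl a => i a | inr b => j b end.

Definition delta_part k l (p : part k l) (i : multi_index N k)
    (j : multi_index N l) : bool :=
  [forall x, forall y, same_block p x y ==> (label i j x == label i j y)].

Definition Tring k l (p : part k l) : 'M[K]_(tdim N l, tdim N k) :=
  \matrix_(b, a) (delta_part p (enum_val a) (enum_val b))%:R.

Definition Tpart k l (p : part k l) : 'M[K]_(tdim N l, tdim N k) :=
  (sqrtC N%:R ^- beta p) *: Tring p.

End PartitionMaps.

(** * Orthogonal projections *)

Section Projections.
Variables (K : numClosedFieldType) (n : nat).

Definition adjmx (P : 'M[K]_n) : 'M[K]_n := map_mx Num.conj P^T.

Definition is_orthoproj (P : 'M[K]_n) : Prop := P *m P = P /\ adjmx P = P.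

Definition orthoproj_le (P Q : 'M[K]_n) : Prop := Q *m P = P.

Definition is_orthoproj_sup (M S : set 'M[K]_n) (Q : 'M[K]_n) : Prop :=
  [/\ M Q, is_orthoproj Q,
      forall P, S P -> orthoproj_le P Q
    & forall Q', M Q' -> is_orthoproj Q' ->
        (forall P, S P -> orthoproj_le P Q') -> orthoproj_le Q Q'].

Definition orthoproj_sup (M S : set 'M[K]_n) : 'M[K]_n :=
  xget 0 (is_orthoproj_sup M S).

End Projections.

(** * Compact matrix quantum groups *)

Record star_algebra (K : numClosedFieldType) := StarAlgebra {
  sa_sort :> algType K;
  star : sa_sort -> sa_sort;
  starD : forall a b, star (a + b) = star a + star b;
  starZ : forall (c : K) a, star (c *: a) = Num.conj c *: star a;
  starM : forall a b, star (a * b) = star b * star a;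
  starK : forall a, star (star a) = a
}.

Definition is_star_morphism K (A B : star_algebra K) (f : A -> B) : Prop :=
  forall a, f (star a) = star (f a).

Definition bilinear_map (K : numClosedFieldType) (A V : lmodType K)
    (f : A -> A -> V) : Prop :=
  forall (c : K) (a a' b : A),
    f (c *: a + a') b = c *: f a b + f a' b /\
    f b (c *: a + a') = c *: f b a + f b a'.

(* [B] is the algebraic tensor product of [A] with itself, where [i1 a] stands
   for a (x) 1 and [i2 b] for 1 (x) b. *)
Definition is_tensor_square (K : numClosedFieldType) (A B : star_algebra K)
    (i1 i2 : {lrmorphism A -> B}) : Prop :=
  [/\ is_star_morphism i1, is_star_morphism i2,
      forall a b, i1 a * i2 b = i2 b * i1 a
    & forall (V : lmodType K) (f : A -> A -> V), bilinear_map f ->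
        exists! F : B -> V, linear F /\ forall a b, F (i1 a * i2 b) = f a b].

(* A quantum subgroup of O_N^+, given by its coordinate Hopf *-algebra, the
   *-subalgebra of C(G) generated by the entries of the fundamental
   representation.  This is the part of C(G) that does not depend on the choice
   of a C*-completion, and it contains the coefficients of all finite-dimensional
   representations.  Since the algebra is generated by the [fund i j], the
   identities imposed on generators imply coassociativity, the counit and
   antipode identities, and the compatibility of these maps with [star]. *)
Record cmqg (K : numClosedFieldType) (N : nat) := CMQG {
  coord : star_algebra K;
  fund : 'M[coord]_N;
  fund_star : forall i j, star (fund i j) = fund i j;
  fund_orthol : fund^T *m fund = 1%:M;
  fund_orthor : fund *m fund^T = 1%:M;
  fund_gen : forall S : set coord,
    S 1 -> (forall (c : K) a b, S a -> S b -> S (c *: a + b)) ->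
    (forall a b, S a -> S b -> S (a * b)) ->
    (forall i j, S (fund i j)) -> forall a, S a;
  coord2 : star_algebra K;
  coord2l : {lrmorphism coord -> coord2};
  coord2r : {lrmorphism coord -> coord2};
  coord2_tensor : is_tensor_square coord2l coord2r;
  comult : {lrmorphism coord -> coord2};
  comult_star : is_star_morphism comult;
  comult_fund : forall i j,
    comult (fund i j) = \sum_h coord2l (fund i h) * coord2r (fund h j);
  counit : {lrmorphism coord -> K^o};
  counit_fund : forall i j, counit (fund i j) = (i == j)%:R;
  antipode : {linear coord -> coord};
  antipode1 : antipode 1 = 1;
  antipodeM : forall a b, antipode (a * b) = antipode b * antipode a;
  antipode_fund : forall i j, antipode (fund i j) = fund j i
}.

Section Representations.
Variables (K : numClosedFieldType) (N : nat) (G : cmqg K N).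

(* A matrix of complex numbers as a matrix over the coordinate algebra. *)
Definition scal_mx m n (T : 'M[K]_(m, n)) : 'M[coord G]_(m, n) :=
  map_mx (in_alg (coord G)) T.

(* Representations are invertible rather than unitary matrices; every such
   representation is equivalent to a unitary one. *)
Definition is_rep n (v : 'M[coord G]_n) : Prop :=
  (forall i j,
     comult G (v i j) = \sum_h coord2l G (v i h) * coord2r G (v h j)) /\
  (exists w : 'M[coord G]_n, w *m v = 1%:M /\ v *m w = 1%:M).

Definition Hom m n (v : 'M[coord G]_m) (w : 'M[coord G]_n) : set 'M[K]_(n, m) :=
  fun T => scal_mx T *m v = w *m scal_mx T.

Definition equiv_rep m n (v : 'M[coord G]_m) (w : 'M[coord G]_n) : Prop :=
  exists (T : 'M[K]_(n, m)) (T' : 'M[K]_(m, n)),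
    [/\ Hom v w T, T' *m T = 1%:M & T *m T' = 1%:M].

(* A subrepresentation of [v] is a representation [w] with an injective
   intertwiner to [v]; irreducibility leaves only 0 and [v] itself. *)
Definition irreducible_rep n (v : 'M[coord G]_n) : Prop :=
  [/\ is_rep v, (0 < n)%N
    & forall m (w : 'M[coord G]_m) (E : 'M[K]_(n, m)),
        is_rep w -> Hom w v E -> \rank E = m -> m = 0%N \/ m = n].

Definition fund_pow k : 'M[coord G]_(tdim N k) :=
  \matrix_(a, b) \prod_(s < k)
    fund G ((enum_val a : multi_index N k) s) ((enum_val b : multi_index N k) s).

(* The restriction of [v] to the range of an idempotent [P] in [Hom v v], that
   is (id (x) P)(v), in the basis of the range given by the columns of
   [col_base P]: the product of [col_base P] and [row_base P] is [P], and their
   product in the other order is the identity. *)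
Definition sub_rep n (v : 'M[coord G]_n) (P : 'M[K]_n) : 'M[coord G]_(\rank P) :=
  scal_mx (row_base P) *m v *m scal_mx (col_base P).

(* [G] is the easy quantum group associated with [C] and [N].  By Tannaka-Krein
   duality this determines [G], and the inclusion of S_N in [G] follows. *)
Definition is_easy (C : part_family) : Prop :=
  forall k l (X : 'M[K]_(tdim N l, tdim N k)),
    Hom (fund_pow k) (fund_pow l) X
    <-> X \in <<[seq Tpart K N p | p in C k l]>>%VS.

Definition R_part (C : part_family) k (p : part k k) : 'M[K]_(tdim N k) :=
  orthoproj_sup (Hom (fund_pow k) (fund_pow k))
    (fun X => exists q, [/\ q \in Proj C k, sdominated q p & X = Tpart K N q]).

Definition P_part (C : part_family) k (p : part k k) : 'M[K]_(tdim N k) :=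
  Tpart K N p - R_part C p.

Definition u_dim (C : part_family) k (p : part k k) : nat := \rank (P_part C p).

Definition u_part (C : part_family) k (p : part k k) : 'M[coord G]_(u_dim C p) :=
  sub_rep (fund_pow k) (P_part C p).

Definition any_rep := {n : nat & 'M[coord G]_n}.

Definition rep_class n (v : 'M[coord G]_n) : set any_rep :=
  fun w => equiv_rep v (projT2 w).

Definition Irr : set (set any_rep) :=
  fun c => exists n (v : 'M[coord G]_n), irreducible_rep v /\ c = rep_class v.

End Representations.

Definition any_part := {k : nat & part k k}.

Definition part_class (C : part_family) k (p : part k k) : set any_part :=
  fun q => projT2 q \in Proj C (projT1 q) /\ equiv_part C p (projT2 q).

Definition Proj_classes (C : part_family) : set (set any_part) :=
  fun c => exists k (p : part k k), p \in Proj C k /\ c = part_class C p.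

(* Main.v *)
Require Import Defs.
From mathcomp Require Import boolp classical_sets functions reals.
From mathcomp Require Import all_boot all_order all_algebra.
From mathcomp.real_closed Require Import complex.

Set Implicit Arguments.
Unset Strict Implicit.
Unset Printing Implicit Defensive.

Import Defs GRing.Theory Num.Theory.
Local Open Scope ring_scope.

(** A partition [p] is a relation [delta_part p] between labellings of its upper
    and of its lower row. Composition and involution of partitions are composition
    and converse of these relations, and two labels are enough to recover [p] from
    its relation. Identities between partitions, such as [r r^* r = r], are
    therefore checked on labellings, and [T_q T_p] is a nonzero multiple of
    [T_(qp)] ([Tring_mul]).

    Irreducibility. The endomorphisms of [u_p] are spanned by the [P_p T_r P_p]
    with [r] in [C(k, k)], and [r] may be replaced by [r' = p r p]. Both
    [r'^* r'] and [r' r'^*] are projective, belong to [C] and are dominated by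
    [p]. If one of them is not [p], its map is killed by [P_p], and
    [P_p T_r' P_p = 0]. If both are [p], then [r'] permutes the through-blocks of
    [p]; without crossings the permutation is trivial and [r' = p]
    ([noncrossing_unitary]). So [u_p] has only scalar endomorphisms, and it is
    irreducible by complete reducibility of unitary representations
    ([orthoproj_subrep]). In the same way a nonzero intertwiner from [u_p] to
    [u_q] requires an [r] with [r^* r = p] and [r r^* = q] ([P_part_sandwich]);
    conversely the map of such an [r] carries [u_p] onto [u_q]
    ([P_part_Tring]).

    Non-vanishing, where [N >= 4] is used. Put alternately e_0 - e_1 and
    e_2 - e_3 on the through-blocks of [p], from left to right. The resulting
    vector is not killed by [T_p]. A noncrossing [q] strictly below [p] either
    joins two neighbouring through-blocks of [p], on which the vector has no
    common label, or cuts off a single through-block, over whose labels it sums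
    the vector to 0. So all these [T_q] kill the vector ([alt_vector_kill]), hence
    so does [R_p], and [P_p] does not vanish.

    Exhaustion. The coefficients of a representation [v] are coefficients of a
    finite direct sum [w] of tensor powers. The linear relations between the
    coefficients of [w] form a subspace which is stable under the slices of the
    comultiplication, and the antipode makes its orthogonal complement stable
    too; lifting a row of [v] to this complement produces a nonzero intertwiner
    [T] from [v] to a tensor power ([rep_Hom_fund_pow]). If [v] is irreducible and
    [p] is minimal with [T_p T <> 0], then [P_p T = T_p T] identifies [v] with
    [u_p] ([irreducible_is_u_part]). *)

(** * Partitions as equivalence relations *)

Lemma same_blockE (T : finType) (p : partn T) (x y : T) :
  same_block p x y = (y \in pblock (blocks p) x).
Proof.
have /and3P[/eqP cov triv _] := valP p.
by rewrite /same_block eq_pblock // cov inE.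
Qed.

Lemma same_block_refl (T : finType) (p : partn T) : reflexive (same_block p).
Proof. by move=> x; rewrite /same_block. Qed.

Lemma same_block_sym (T : finType) (p : partn T) : symmetric (same_block p).
Proof. by move=> x y; rewrite /same_block eq_sym. Qed.

Lemma same_block_trans (T : finType) (p : partn T) : transitive (same_block p).
Proof. by move=> y x z; rewrite /same_block => /eqP->. Qed.

Lemma same_block_fibre (T : finType) (rT : eqType) (f : T -> rT) x y :
  same_block (fibre_partn f) x y = (f x == f y).
Proof.
rewrite same_blockE /blocks /= /preim_partition.
rewrite (@pblock_equivalence_partition _ (fun x y => f x == f y)) ?inE //.
by split=> // /eqP->.
Qed.

Lemma partn_ext (T : finType) (p q : partn T) :
  (forall x y, same_block p x y = same_block q x y) -> p = q.
Proof.
move=> epq; apply: val_inj.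
rewrite -(equivalence_partition_pblock (valP p)).
rewrite -(equivalence_partition_pblock (valP q)).
apply: eq_imset => x; apply/setP=> y; rewrite !inE.
by have := epq x y; rewrite !same_blockE.
Qed.

Lemma same_block_star k l (p : part k l) x y :
  same_block (star_part p) x y = same_block p (swap_points x) (swap_points y).
Proof. by rewrite same_block_fibre. Qed.

(** * The relation on labellings attached to a partition *)

Lemma delta_partP k l N (p : part k l) (i : {ffun 'I_k -> 'I_N})
    (j : {ffun 'I_l -> 'I_N}) :
  reflect (forall x y, same_block p x y -> label i j x = label i j y)
          (delta_part p i j).
Proof.
apply: (iffP forallP) => [h x y sxy | h x].
  by have /forallP/(_ y)/implyP/(_ sxy)/eqP := h x.
by apply/forallP=> y; apply/implyP=> /h->.
Qed.

Lemma delta_star k l N (p : part k l) (i : {ffun 'I_l -> 'I_N})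
    (j : {ffun 'I_k -> 'I_N}) :
  delta_part (star_part p) i j = delta_part p j i.
Proof.
have lab x : label i j x = label j i (swap_points x) by case: x.
apply/delta_partP/delta_partP=> h x y.
  move=> sxy; have := h (swap_points x) (swap_points y).
  by rewrite same_block_star !lab; case: x sxy => x; case: y => y /= sxy; apply.
by rewrite same_block_star !lab; apply: h.
Qed.

Definition stack_label k l m N (i : {ffun 'I_k -> 'I_N})
    (h : {ffun 'I_l -> 'I_N}) (j : {ffun 'I_m -> 'I_N})
    (x : ('I_k + 'I_l) + 'I_m) : 'I_N :=
  match x with inl x => label i h x | inr y => j y end.

Lemma stack_edge_sym k l m (p : part k l) (q : part l m) :
  connect_sym (stack_edge p q).
Proof.
apply: sym_connect_sym => x y; rewrite /stack_edge; congr (_ || _).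
  by apply/existsP/existsP=> -[a /existsP[b /and3P[? ? ?]]];
    exists b; apply/existsP; exists a; apply/and3P; rewrite same_block_sym.
by apply/existsP/existsP=> -[a /existsP[b /and3P[? ? ?]]];
  exists b; apply/existsP; exists a; apply/and3P; rewrite same_block_sym.
Qed.

Lemma same_block_comp k l m (p : part k l) (q : part l m) x y :
  same_block (comp_part p q) x y =
  connect (stack_edge p q) (stack_outer l x) (stack_outer l y).
Proof.
rewrite same_block_fibre; apply/eqP/idP=> [e | c].
  by move/setP/(_ (stack_outer l y)): e; rewrite !inE connect0.
by apply/setP=> z; rewrite !inE (same_connect (stack_edge_sym p q) c).
Qed.

Lemma stack_labelP k l m N (p : part k l) (q : part l m)
    (i : {ffun 'I_k -> 'I_N}) h (j : {ffun 'I_m -> 'I_N}) :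
  reflect (forall x y, connect (stack_edge p q) x y ->
             stack_label i h j x = stack_label i h j y)
          (delta_part p i h && delta_part q h j).
Proof.
have lab x : stack_label i h j (stack_of_bottom k x) = label h j x by case: x.
apply: (iffP andP) => [[/delta_partP dp /delta_partP dq] x y | c].
  have edge u v : stack_edge p q u v -> stack_label i h j u = stack_label i h j v.
    case/orP=> /existsP[a /existsP[b /and3P[/eqP<- /eqP<- s]]].
      exact: dp.
    by rewrite !lab; apply: dq.
  case/connectP=> s; elim: s x => [|z s IH] x /=; first by move=> _ ->.
  by case/andP=> /edge-> /IH e /e.
split; apply/delta_partP=> x y s.
  apply: (c (inl x) (inl y)); apply: connect1; apply/orP; left.
  by apply/existsP; exists x; apply/existsP; exists y; rewrite !eqxx.
rewrite -!lab; apply: c; apply: connect1; apply/orP; right.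
by apply/existsP; exists x; apply/existsP; exists y; rewrite !eqxx.
Qed.

Definition middle_labels k l m N (p : part k l) (q : part l m)
    (i : {ffun 'I_k -> 'I_N}) (j : {ffun 'I_m -> 'I_N}) :
    {set {ffun 'I_l -> 'I_N}} :=
  [set h | delta_part p i h && delta_part q h j]%SET.

Lemma stack_label_outer k l m N (i : {ffun 'I_k -> 'I_N})
    (h : {ffun 'I_l -> 'I_N}) (j : {ffun 'I_m -> 'I_N}) x :
  stack_label i h j (stack_outer l x) = label i j x.
Proof. by case: x. Qed.

(** Points of the middle row that are joined to an outer point have no freedom,
    the others do not see the outer labels: so an admissible labelling of the
    middle row for [(i, j)] is turned into one for [(i', j')] by relabelling the
    points of the first kind. *)
Lemma card_middle_labels_le k l m N (p : part k l) (q : part l m)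
    (i i' : {ffun 'I_k -> 'I_N}) (j j' : {ffun 'I_m -> 'I_N}) :
  delta_part (comp_part p q) i j -> delta_part (comp_part p q) i' j' ->
  (#|middle_labels p q i j| <= #|middle_labels p q i' j'|)%N.
Proof.
move=> /delta_partP d /delta_partP d'.
pose e := connect (stack_edge p q).
have esym : symmetric e := stack_edge_sym p q.
pose out z := [pick x | e (stack_outer l x) z].
pose F (h : {ffun 'I_l -> 'I_N}) : {ffun 'I_l -> 'I_N} :=
  [ffun y => if out (inl (inr y)) is Some x then label i' j' x else h y].
have outE z x : e (stack_outer l x) z -> exists2 x', out z = Some x' &
    e (stack_outer l x') z.
  rewrite /out; case: pickP => [x' ex' _|/(_ x)->//].
  by exists x'.
have labF h z : stack_label i' (F h) j' z =
    if out z is Some x then label i' j' x else stack_label i h j z.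
  have outer x : stack_label i' (F h) j' (stack_outer l x) =
    if out (stack_outer l x) is Some x' then label i' j' x'
    else stack_label i h j (stack_outer l x).
    have [x' -> ex'] := outE _ x (connect0 _ _).
    rewrite stack_label_outer; apply: d'.
    by rewrite same_block_comp -/e esym.
  case: z => [[a|y]|b]; [exact: (outer (inl a)) | | exact: (outer (inr b))].
  by rewrite /= ffunE.
have outC u v : e u v ->
    match out u, out v with
    | Some x, Some y => label i' j' x = label i' j' y
    | None, None => True | _, _ => False end.
  move=> euv; case ou: (out u) => [x|].
    have exu : e (stack_outer l x) u.
      by move: ou; rewrite /out; case: pickP => // x' ex' [<-].
    have [y -> ey] := outE v x (connect_trans exu euv).
    apply: d'; rewrite same_block_comp; apply: connect_trans exu _.
    by apply: connect_trans euv _; rewrite -/e esym.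
  case ov: (out v) => [y|//].
  have eyv : e (stack_outer l y) v.
    by move: ov; rewrite /out; case: pickP => // x' ex' [<-].
  have evu : e v u by rewrite esym.
  by have [x'] := outE u y (connect_trans eyv evu); rewrite ou.
have sub : [set F h | h in middle_labels p q i j]%SET \subset
    middle_labels p q i' j'.
  apply/subsetP=> _ /imsetP[h hm ->]; move: hm; rewrite !inE => /stack_labelP c.
   apply/stack_labelP=> u v euv; rewrite !labF.
  by have := outC _ _ euv; case: (out u) (out v) => [x|] [y|] // _; apply: c.
rewrite -(card_in_imset (f := F) (D := middle_labels p q i j)).
  exact: subset_leq_card sub.
move=> h1 h2; rewrite !inE => /stack_labelP c1 /stack_labelP c2 eF.
apply/ffunP=> y; move/ffunP/(_ y): eF; rewrite !ffunE.
case oy: (out _) => [x|//] _.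
have exy : e (stack_outer l x) (inl (inr y)).
  by move: oy; rewrite /out; case: pickP => // x' ex' [<-].
have := c1 _ _ exy; have := c2 _ _ exy; rewrite !stack_label_outer /=.
by move=> <- <-.
Qed.

(** This is [N] to the power of the number of components that are confined to the
    middle row and disappear in the composition. *)
Definition nb_middle k l m N (z : 'I_N) (p : part k l) (q : part l m) : nat :=
  #|middle_labels p q [ffun=> z] [ffun=> z]|.

Lemma delta_const k l N (z : 'I_N) (p : part k l) :
  delta_part p [ffun=> z] [ffun=> z].
Proof. by apply/delta_partP=> -[x|x] [y|y] _ /=; rewrite !ffunE. Qed.

Lemma nb_middle_gt0 k l m N (z : 'I_N) (p : part k l) (q : part l m) :
  (0 < nb_middle z p q)%N.
Proof.
apply/card_gt0P; exists [ffun=> z].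
by rewrite inE !delta_const.
Qed.

Lemma card_middle_labels k l m N (z : 'I_N) (p : part k l) (q : part l m)
    (i : {ffun 'I_k -> 'I_N}) (j : {ffun 'I_m -> 'I_N}) :
  #|middle_labels p q i j| =
  if delta_part (comp_part p q) i j then nb_middle z p q else 0%N.
Proof.
case: ifP => [d | nd].
  by apply/eqP; rewrite eqn_leq !card_middle_labels_le ?delta_const.
apply/eqP; rewrite cards_eq0; apply/eqP/setP=> h; rewrite !inE.
apply: contraFF nd => /stack_labelP c; apply/delta_partP=> x y.
by rewrite same_block_comp => /c; rewrite !stack_label_outer.
Qed.

Lemma delta_compP k l m N (p : part k l) (q : part l m)
    (i : {ffun 'I_k -> 'I_N.+1}) (j : {ffun 'I_m -> 'I_N.+1}) :
  reflect (exists2 h, delta_part p i h & delta_part q h j)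
          (delta_part (comp_part p q) i j).
Proof.
have := card_middle_labels ord0 p q i j; case: ifP => _ c; constructor.
  have /card_gt0P[h] : (0 < #|middle_labels p q i j|)%N.
    by rewrite c nb_middle_gt0.
  by rewrite inE => /andP[? ?]; exists h.
case=> h hp hq; have : h \in middle_labels p q i j by rewrite inE hp.
by move/eqP: c; rewrite cards_eq0 => /eqP->; rewrite inE.
Qed.

(** Labelling one block by 1 and the other points by 0 separates that block
    from every point outside it; so two labels recover the partition. *)
Lemma same_block_deltaP k l (p : part k l) x y :
  reflect (forall i j : {ffun _ -> 'I_2}, delta_part p i j ->
             label i j x = label i j y)
          (same_block p x y).
Proof.
apply: (iffP idP) => [s i j /delta_partP|]; first exact.
pose f z : 'I_2 := inord (same_block p x z).
have lf z : label [ffun a => f (inl a)] [ffun b => f (inr b)] z = f z.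
  by case: z => z; rewrite /= ffunE.
move/(_ [ffun a => f (inl a)] [ffun b => f (inr b)]).
rewrite !lf /f same_block_refl => h.
have /h/(congr1 val) : delta_part p [ffun a => f (inl a)] [ffun b => f (inr b)].
  apply/delta_partP=> u v suv; rewrite !lf /f; congr inord; congr nat_of_bool.
  by apply/idP/idP=> s; apply: same_block_trans s _; rewrite // same_block_sym.
by rewrite /= !inordK ?ltnS ?leq_b1 //; case: same_block.
Qed.

Lemma part_delta_ext k l (p q : part k l) :
  (forall i j : {ffun _ -> 'I_2}, delta_part p i j = delta_part q i j) -> p = q.
Proof.
move=> e; apply: partn_ext => x y.
by apply/same_block_deltaP/same_block_deltaP=> h i j d; apply: h; rewrite ?e // -e.
Qed.

(** * The algebra of composition and involution *)

Lemma star_partK k l (p : part k l) : star_part (star_part p) = p.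
Proof. by apply: part_delta_ext => i j; rewrite !delta_star. Qed.

Lemma star_part_comp k l m (p : part k l) (q : part l m) :
  star_part (comp_part p q) = comp_part (star_part q) (star_part p).
Proof.
apply: part_delta_ext => i j; rewrite delta_star.
by apply/delta_compP/delta_compP=> -[h]; exists h; rewrite ?delta_star //;
  rewrite -delta_star.
Qed.

Lemma comp_partA k l m n (p : part k l) (q : part l m) (r : part m n) :
  comp_part (comp_part p q) r = comp_part p (comp_part q r).
Proof.
apply: part_delta_ext => i j; apply/delta_compP/delta_compP.
  case=> h /delta_compP[h' d1 d2 d3]; exists h' => //.
  by apply/delta_compP; exists h.
case=> h d1 /delta_compP[h' d2 d3]; exists h' => //.
by apply/delta_compP; exists h.
Qed.

(** Composability of three labellings of [r], [r^*] and [r] already says that the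
    outer rows agree on every block of [r]: the two middle rows carry the labels
    of a through-block from one end to the other. *)
Lemma comp_part_star_self k l (r : part k l) :
  comp_part (comp_part r (star_part r)) r = r.
Proof.
apply: part_delta_ext => i j; apply/delta_compP/idP => [[h]|d]; last first.
  by exists i => //; apply/delta_compP; exists j; rewrite ?delta_star.
case/delta_compP=> h'; rewrite delta_star.
move=> /delta_partP d1 /delta_partP d2 /delta_partP d3.
apply/delta_partP=> -[a|a] [b|b] s.
- exact: d1 s.
- by have := d1 _ _ s; have := d2 _ _ s; have := d3 _ _ s => /= <- <- <-.
- by have := d1 _ _ s; have := d2 _ _ s; have := d3 _ _ s => /= -> -> ->.
exact: d3 s.
Qed.

Lemma projective_comp_star k l (r : part k l) :
  projective (comp_part r (star_part r)).
Proof.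
rewrite /projective star_part_comp star_partK eqxx /=.
by rewrite -comp_partA comp_part_star_self.
Qed.

Lemma Proj_comp_star (C : part_family) k l (r : part k l) :
  is_category C -> r \in C k l -> comp_part r (star_part r) \in Proj C k.
Proof.
move=> catC rC; rewrite inE projective_comp_star andbT.
exact: cat_comp catC _ _ _ _ _ rC (cat_star catC rC).
Qed.

Lemma projective_star k (p : part k k) : projective p -> star_part p = p.
Proof. by case/andP=> /eqP<-. Qed.

Lemma projective_comp k (p : part k k) : projective p -> comp_part p p = p.
Proof. by case/andP=> _ /eqP<-. Qed.

Lemma dominated_comp k (p q : part k k) :
  projective p -> projective q -> dominated q p -> comp_part p q = q.
Proof.
move=> pp pq /eqP/(congr1 (@star_part k k)).
by rewrite star_part_comp (projective_star pp) (projective_star pq).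
Qed.

Lemma dominated_trans k (p q r : part k k) :
  dominated q p -> dominated r q -> dominated r p.
Proof. by move=> /eqP qp /eqP rq; apply/eqP; rewrite -rq comp_partA qp. Qed.

Lemma dominated_anti k (p q : part k k) :
  projective p -> projective q -> dominated q p -> dominated p q -> p = q.
Proof.
by move=> pp pq qp /eqP; rewrite dominated_comp.
Qed.

(** * Blocks of [r^* r] and noncrossing partitions *)

(** Folding the lower copy of [r] onto the upper one maps blocks to blocks, so
    composing [r] with its mirror image joins no new upper points. *)
Lemma same_block_comp_star_uu k l (r : part k l) a b :
  same_block (comp_part r (star_part r)) (inl a) (inl b) =
  same_block r (inl a) (inl b).
Proof.
apply/same_block_deltaP/same_block_deltaP => h i j d.
  by apply: (h i i); apply/delta_compP; exists j; rewrite ?delta_star.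
by case/delta_compP: d => m dm _; apply: (h i m).
Qed.

(** A block reaches the mirror image of its points exactly when it passes through
    the fold, that is, when it has a lower point in [r]. *)
Lemma same_block_comp_star_ul k l (r : part k l) a b :
  same_block (comp_part r (star_part r)) (inl a) (inr b) =
  same_block r (inl a) (inl b) && [exists m, same_block r (inl a) (inr m)].
Proof.
apply/same_block_deltaP/andP => [h | [s /existsP[m t]] i j]; last first.
  case/delta_compP=> n; rewrite delta_star => /delta_partP d1 /delta_partP d2.
  rewrite /= (d1 _ _ t : i a = n m) -(d2 _ _ t : j a = n m).
  exact: d2 _ _ s.
have sab : same_block r (inl a) (inl b).
  apply/same_block_deltaP=> i j d; apply: (h i i).
  by apply/delta_compP; exists j; rewrite ?delta_star.
split=> //; apply: contraT => /existsPn nt.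
(* Without a lower point in its block, the label of [a] can be changed on one
   of the two copies of [r] only. *)
pose z0 : 'I_2 := ord0; pose z1 : 'I_2 := inord 1.
pose f (x : points k l) := if same_block r (inl a) x then z1 else z0.
suff /h : delta_part (comp_part r (star_part r)) [ffun=> z0] [ffun c => f (inl c)].
  rewrite /label !ffunE /f sab => /(congr1 val) /=; by rewrite inordK.
apply/delta_compP; exists [ffun=> z0]; first exact: delta_const.
rewrite delta_star; apply/delta_partP=> u v suv.
have lf x : label [ffun c => f (inl c)] [ffun=> z0] x = f x.
  by case: x => x; rewrite /= ffunE // /f (negPf (nt x)).
rewrite !lf /f; congr (if _ then _ else _).
by apply/idP/idP=> s; apply: same_block_trans s _; rewrite // same_block_sym.
Qed.

(** This is [same_block_comp_star_ul] for [r = p]: a projective partition is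
    determined by its upper row and by the upper points lying in through-blocks,
    which are those joined to their own mirror image. *)
Lemma projective_ul k (p : part k k) a b : projective p ->
  same_block p (inl a) (inr b) =
  same_block p (inl a) (inl b) && same_block p (inl a) (inr a).
Proof.
move=> pp; have e : comp_part p (star_part p) = p.
  by rewrite projective_star // projective_comp.
by rewrite -{1 3}e !same_block_comp_star_ul same_block_refl.
Qed.

Lemma projective_through k (p : part k k) a m : projective p ->
  same_block p (inl a) (inr m) -> same_block p (inl a) (inr a).
Proof. by move=> pp; rewrite projective_ul // => /andP[]. Qed.

Lemma projective_swap k (p : part k k) x y : projective p ->
  same_block p (swap_points x) (swap_points y) = same_block p x y.
Proof. by move=> pp; rewrite -{2}(projective_star pp) same_block_star. Qed.

(** A noncrossing [r] with [r^* r = r r^* = p] permutes the through-blocks of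
    [p]; noncrossing forces this permutation to be increasing, hence trivial.
    By induction on [i]: the partners [m] and [m'] of [i] in the two rows are
    either at most [i], where the induction hypothesis settles the claim, or
    both to the right of [i], where the two strings cross. *)
Lemma noncrossing_unitary k (p r : part k k) : noncrossing r ->
  comp_part r (star_part r) = p -> comp_part (star_part r) r = p -> r = p.
Proof.
move=> nc e1 e2.
have pp : projective p by rewrite -e1 projective_comp_star.
have uu a b : same_block p (inl a) (inl b) = same_block r (inl a) (inl b).
  by rewrite -e1 same_block_comp_star_uu.
have ll a b : same_block p (inl a) (inl b) = same_block r (inr a) (inr b).
  by rewrite -e2 -{2}(star_partK r) same_block_comp_star_uu same_block_star.
have tu a : same_block p (inl a) (inr a) = [exists m, same_block r (inl a) (inr m)].
  by rewrite -e1 same_block_comp_star_ul same_block_refl.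
have tl a : same_block p (inl a) (inr a) = [exists m, same_block r (inr a) (inl m)].
  rewrite -e2 -{2}(star_partK r) same_block_comp_star_ul same_block_refl /=.
  by apply: eq_existsb => m; rewrite same_block_star.
have uT i j : same_block r (inl i) (inr j) -> same_block p (inl i) (inr i).
  by move=> s; rewrite tu; apply/existsP; exists j.
have lT i j : same_block r (inl i) (inr j) -> same_block p (inl j) (inr j).
  by move=> s; rewrite tl; apply/existsP; exists i; rewrite same_block_sym.
have diag (i : 'I_k) : same_block p (inl i) (inr i) -> same_block r (inl i) (inr i).
  have [n] := ubnP (nat_of_ord i); elim: n i => // n IH i; rewrite ltnS => lin ti.
  have /existsP[m sm] : [exists m, same_block r (inl i) (inr m)] by rewrite -tu.
  have /existsP[m' sm'] : [exists m', same_block r (inr i) (inl m')] by rewrite -tl.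
  rewrite same_block_sym in sm'.
  have [lt_m | ] := ltnP m i.
    have smm := IH m (leq_trans lt_m lin) (lT _ _ sm).
    have : same_block r (inl i) (inl m).
      by apply: same_block_trans sm _; rewrite same_block_sym.
    rewrite -uu ll => s; apply: same_block_trans sm _.
    by rewrite same_block_sym.
  rewrite leq_eqVlt => /orP[/eqP/val_inj e | lt_m].
    by rewrite {2}e.
  have [lt_m' | ] := ltnP m' i.
    have smm := IH m' (leq_trans lt_m' lin) (uT _ _ sm').
    have : same_block r (inr i) (inr m').
      by rewrite same_block_sym in sm'; apply: same_block_trans sm' _.
    rewrite -ll uu => s; exact: same_block_trans s sm'.
  rewrite leq_eqVlt => /orP[/eqP/val_inj e | lt_m'].
    by rewrite {1}e.
  have : same_block r (inl i) (inl m').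
    apply: (nc (inl i) (inl m') (inr m) (inr i)) => //=.
      by rewrite (leq_trans (ltn_ord m')) ?leq_addr.
    by rewrite ltn_add2l ltn_sub2l // (leq_ltn_trans lt_m (ltn_ord m)).
  by move=> s; apply: same_block_trans s sm'.
have ul i j : same_block r (inl i) (inr j) = same_block p (inl i) (inr j).
  rewrite (projective_ul _ _ pp); apply/idP/andP => [s | [s ti]].
    have ti := uT _ _ s; split=> //; rewrite ll.
    by apply: same_block_trans s; rewrite same_block_sym; apply: diag.
  by apply: same_block_trans (diag _ ti) _; rewrite -ll.
apply: partn_ext => -[a|a] [b|b].
- by rewrite uu.
- exact: ul.
- by rewrite same_block_sym ul same_block_sym.
by rewrite -ll -(projective_swap _ _ pp).
Qed.

(* Composed partitions are compared by rewriting, never by unfolding. *)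
Local Opaque comp_part star_part.

(** * Conjugate transposes and orthogonal projections *)

Definition ctr (K : numClosedFieldType) m n (A : 'M[K]_(m, n)) : 'M[K]_(n, m) :=
  map_mx Num.conj A^T.

Lemma ctrK (K : numClosedFieldType) m n (A : 'M[K]_(m, n)) : ctr (ctr A) = A.
Proof. by apply/matrixP=> i j; rewrite !mxE conjCK. Qed.

Lemma ctr_mul (K : numClosedFieldType) m n p (A : 'M[K]_(m, n)) (B : 'M_(n, p)) :
  ctr (A *m B) = ctr B *m ctr A.
Proof. by rewrite /ctr trmx_mul map_mxM. Qed.

Lemma ctrB (K : numClosedFieldType) m n (A B : 'M[K]_(m, n)) :
  ctr (A - B) = ctr A - ctr B.
Proof. by apply/matrixP=> i j; rewrite !mxE rmorphB. Qed.

Lemma ctrZ (K : numClosedFieldType) m n a (A : 'M[K]_(m, n)) :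
  ctr (a *: A) = a^* *: ctr A.
Proof. by apply/matrixP=> i j; rewrite !mxE rmorphM. Qed.

Lemma ctr0 (K : numClosedFieldType) m n : ctr 0 = 0 :> 'M[K]_(m, n).
Proof. by apply/matrixP=> i j; rewrite !mxE conjC0. Qed.

Lemma ctr_inj (K : numClosedFieldType) m n : injective (@ctr K m n).
Proof. exact: can_inj (@ctrK K m n). Qed.

Lemma ctr_mul_sum_eq0 (K : numClosedFieldType) (I : finType) (P : pred I) m n
    (B : I -> 'M[K]_(m, n)) :
  \sum_(i | P i) ctr (B i) *m B i = 0 -> forall i, P i -> B i = 0.
Proof.
move=> s0 i Pi; apply/matrixP=> a b; rewrite mxE.
have /eqP := congr1 (fun M : 'M_n => M b b) s0; rewrite summxE mxE.
rewrite psumr_eq0 => [/allP/(_ i)|{Pi}i _]; last first.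
  by rewrite mxE sumr_ge0 // => h _; rewrite !mxE mulrC mul_conjC_ge0.
rewrite mem_index_enum Pi => /(_ isT)/=; rewrite mxE psumr_eq0 => [|h _].
  move=> /allP/(_ a); rewrite mem_index_enum !mxE mulrC mul_conjC_eq0.
  by move=> /(_ isT)/eqP.
by rewrite !mxE mulrC mul_conjC_ge0.
Qed.

Lemma ctr_mul_eq0 (K : numClosedFieldType) m n (B : 'M[K]_(m, n)) :
  ctr B *m B = 0 -> B = 0.
Proof.
move=> B0; apply: (@ctr_mul_sum_eq0 K 'I_1 xpredT m n (fun=> B) _ ord0 isT).
by rewrite big_ord1.
Qed.

(** A hermitian element [A] of a unital matrix algebra [M] has its support
    projection in [M]: left multiplication by [A] is injective on [A M], hence
    onto, so that [A = A A X] with [X] in [M], and [A X] is the projection. *)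
Lemma hermitian_support (K : numClosedFieldType) n (M : {vspace 'M[K]_n})
    (A : 'M[K]_n) :
  (forall X Y, X \in M -> Y \in M -> X *m Y \in M) -> 1%:M \in M -> A \in M ->
  ctr A = A ->
  exists X, [/\ X \in M, is_orthoproj (A *m X) & A *m X *m A = A].
Proof.
move=> mulM oneM AM Ah.
pose f := linfun (mulmx A : 'M_n -> 'M_n); pose U := (f @: M)%VS.
have fE X : f X = A *m X by rewrite lfunE.
have fU : (f @: U <= U)%VS.
  apply/subvP=> _ /memv_imgP[Y /memv_imgP[X XM ->] ->].
  by rewrite [f X]fE; apply: memv_img; apply: mulM.
have inj : (U :&: lker f = 0)%VS.
  apply/eqP; rewrite -subv0; apply/subvP=> _ /memv_capP[/memv_imgP[X _ ->]].
  rewrite memv_ker memv0 !fE => /eqP A0; apply/eqP/ctr_mul_eq0.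
  by rewrite ctr_mul Ah -mulmxA A0 mulmx0.
have eU : (f @: U = U)%VS.
  by apply/eqP; rewrite eqEdim fU (limg_dim_eq inj) leqnn.
have : A \in (f @: U)%VS by rewrite eU -[A]mulmx1 -fE memv_img.
case/memv_imgP=> _ /memv_imgP[X XM ->]; rewrite !fE => eA.
have eA' : A = ctr X *m A *m A.
  by have := congr1 (@ctr K n n) eA; rewrite !ctr_mul !Ah.
have QQ : ctr X *m A *m (A *m X) = A *m X by rewrite mulmxA -eA'.
have Qh : ctr (A *m X) = A *m X by rewrite -{1}QQ !ctr_mul ctrK !Ah QQ.
exists X; split=> //; last by rewrite -{1}Qh ctr_mul Ah -eA'.
by split=> //; rewrite -{1}Qh ctr_mul Ah QQ.
Qed.

(** The column space of [F] is that of the hermitian matrix [F F^*], to which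
    [hermitian_support] applies. *)
Lemma orthoproj_range (K : numClosedFieldType) m n (F : 'M[K]_(m, n)) :
  exists X : 'M[K]_(n, m), is_orthoproj (F *m X) /\ F *m X *m F = F.
Proof.
have h : ctr (F *m ctr F) = F *m ctr F by rewrite ctr_mul ctrK.
have [X [_ oP e]] :=
  hermitian_support (fun X Y _ _ => memvf (X *m Y)) (memvf 1%:M) (memvf _) h.
exists (ctr F *m X); rewrite mulmxA; split=> //.
set Q := F *m ctr F *m X in e oP *; apply/eqP; rewrite -subr_eq0.
have -> : Q *m F - F = (Q - 1%:M) *m F by rewrite mulmxBl mul1mx.
apply/eqP/ctr_inj/eqP; rewrite ctr0; apply/eqP/ctr_mul_eq0.
by rewrite ctrK ctr_mul mulmxA -[_ *m F *m _]mulmxA mulmxBl e mul1mx subrr mul0mx.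
Qed.

(** The supremum of projections is the support of their sum, because the
    complement of the support kills the sum and hence, by positivity, each of
    them. The factorization shows that the supremum kills every vector that the
    given projections kill. *)
Lemma orthoproj_sup_correct (K : numClosedFieldType) n (M : {vspace 'M[K]_n})
    (I : finType) (P : pred I) (F : I -> 'M[K]_n) (S : set 'M[K]_n)
    (M' : set 'M[K]_n) :
  (forall X, M' X <-> X \in M) ->
  (forall X Y, X \in M -> Y \in M -> X *m Y \in M) -> 1%:M \in M ->
  (forall i, P i -> F i \in M) -> (forall i, P i -> is_orthoproj (F i)) ->
  (forall X, S X <-> exists2 i, P i & X = F i) ->
  let Q := orthoproj_sup M' S in
  is_orthoproj_sup M' S Q /\ exists X, Q = (\sum_(i | P i) F i) *m X.
Proof.
move=> eM mulM oneM FM Fo eS /=; set A := \sum_(i | P i) F i.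
have AM : A \in M by apply: memv_suml.
have Ah : ctr A = A.
  rewrite /A /ctr raddf_sum map_mx_sum; apply: eq_bigr => i Pi.
  by have [_] := Fo i Pi.
have [X [XM Qo QA]] := hermitian_support mulM oneM AM Ah.
have Qsup : is_orthoproj_sup M' S (A *m X).
  split=> //; first by apply/eM; apply: mulM.
    move=> _ /eS[i Pi ->]; rewrite /orthoproj_le.
    have [_ Qh] := Qo; set Q := A *m X in QA Qh *.
    rewrite -[adjmx _]/(ctr _) in Qh.
    have AQ : A *m Q = A by have := congr1 (@ctr K n n) QA; rewrite ctr_mul Qh Ah.
    have B0 : F i *m (1%:M - Q) = 0.
      apply: (@ctr_mul_sum_eq0 K I P n n (fun i => F i *m (1%:M - Q)) _ i Pi).
      rewrite (eq_bigr (fun i => ctr (1%:M - Q) *m (F i *m (1%:M - Q)))); last first.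
        move=> h Ph; rewrite ctr_mul -mulmxA (mulmxA _ (F h)).
        by have [oo oh] := Fo h Ph; rewrite -[adjmx _]/(ctr _) in oh; rewrite oh oo.
      rewrite -mulmx_sumr -mulmx_suml mulmxBr mulmx1.
      by rewrite -/A AQ subrr mulmx0.
    apply/eqP; rewrite -subr_eq0 -oppr_eq0 opprB; apply/eqP/ctr_inj.
    rewrite ctr0 ctrB ctr_mul Qh.
    have [_] := Fo i Pi; rewrite -[adjmx _]/(ctr _) => ->.
    by rewrite -{1}[F i]mulmx1 -mulmxBr.
  move=> Q' _ _ le; rewrite /orthoproj_le mulmxA; congr (_ *m X).
  rewrite mulmx_sumr; apply: eq_bigr => i Pi; apply: le; apply/eS.
  by exists i.
have gsup := @xgetPex _ 0 (is_orthoproj_sup M' S) (ex_intro _ _ Qsup).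
split=> //; exists X.
case: gsup (Qsup) => M1 o1 le1 min1 [M2 o2 le2 min2].
have e1 := min1 _ M2 o2 le2; have e2 := min2 _ M1 o1 le1.
rewrite /orthoproj_le in e1 e2.
have := congr1 (@ctr K n n) e1; rewrite ctr_mul.
rewrite -[ctr (A *m X)]/(adjmx _) o2.2 -[ctr _]/(adjmx _) o1.2.
by rewrite e2 => ->.
Qed.

(** * The maps attached to partitions *)

Lemma sum_enum_val (V : nmodType) (T : finType) (F : T -> V) :
  \sum_(c < #|{: T}|) F (enum_val c) = \sum_(x : T) F x.
Proof. by rewrite -(big_enum_val (A := {: T})). Qed.

Lemma Tring_mul (K : numClosedFieldType) N k l m (p : part k l) (q : part l m) :
  Tring K N.+1 q *m Tring K N.+1 p =
  (nb_middle (ord0 : 'I_N.+1) p q)%:R *: Tring K N.+1 (comp_part p q).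
Proof.
apply/matrixP=> b a; rewrite !mxE.
pose F (h : {ffun 'I_l -> 'I_N.+1}) : K :=
  (delta_part p (enum_val a) h && delta_part q h (enum_val b))%:R.
rewrite (eq_bigr (fun c => F (enum_val c))) => [|c _]; last first.
  by rewrite !mxE /F -natrM mulnb andbC.
rewrite sum_enum_val.
transitivity (#|middle_labels p q (enum_val a) (enum_val b)|%:R : K).
  rewrite -sum1_card natr_sum [RHS]big_mkcond; apply: eq_bigr => h _.
  by rewrite /F inE; case: (_ && _).
rewrite (card_middle_labels ord0).
by case: delta_part; rewrite ?mulr1 ?mulr0.
Qed.

Lemma nb_middle_neq0 (K : numClosedFieldType) N k l m (p : part k l) (q : part l m) :
  (nb_middle (ord0 : 'I_N.+1) p q)%:R != 0 :> K.
Proof. by rewrite pnatr_eq0 -lt0n nb_middle_gt0. Qed.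

Lemma ctr_Tring (K : numClosedFieldType) N k l (p : part k l) :
  ctr (Tring K N p) = Tring K N (star_part p).
Proof.
by apply/matrixP=> a b; rewrite !mxE delta_star conjC_nat.
Qed.

(** A labelling of the upper row and one of the lower row, each compatible with
    [z] on the other side, are together a labelling of the blocks which is [z]
    on the through-blocks and arbitrary on the others. *)
Lemma card_outer_labels N k l (z : 'I_N) (p : part k l) :
  (#|[set i : {ffun 'I_k -> 'I_N} | delta_part p i [ffun=> z]]%SET| *
   #|[set j : {ffun 'I_l -> 'I_N} | delta_part p [ffun=> z] j]%SET|)%N =
  (N ^ beta p)%N.
Proof.
pose D := [set B in blocks p | ~~ is_through_block B]%SET.
have -> : beta p = #|D|.
  rewrite /beta /nb_blocks /nb_through -cardsDS; last first.
    by apply/subsetP=> B; rewrite inE => /andP[].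
  by apply: eq_card => B; rewrite !inE; case: (B \in blocks p); rewrite ?andbT ?andbF.
have cD := @card_pffun_on {set points k l} 'I_N z (mem D) predT.
rewrite card_ord in cD; rewrite -[#|D|]/#|mem D| -{}cD.
have mB x : pblock (blocks p) x \in blocks p.
  by apply: pblock_mem; have /and3P[/eqP-> _ _] := valP p; rewrite inE.
have Bx x B : B \in blocks p -> x \in B -> pblock (blocks p) x = B.
  by have /and3P[_ t _] := valP p; apply: def_pblock.
have xB x : x \in pblock (blocks p) x.
  by rewrite -same_blockE same_block_refl.
have thr a b : same_block p (inl a) (inr b) ->
    pblock (blocks p) (inl a) \notin D.
  move=> s; rewrite !inE mB /= negbK /is_through_block.
  apply/andP; split; apply/existsP; first by exists a.
  by exists b; rewrite -same_blockE.
rewrite -cardsX; pose L (g : {ffun {set points k l} -> 'I_N}) :=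
  ([ffun a => g (pblock (blocks p) (inl a))],
   [ffun b => g (pblock (blocks p) (inr b))]).
have Lx g x : label (L g).1 (L g).2 x = g (pblock (blocks p) x).
  by case: x => x; rewrite /= ffunE.
rewrite -(card_in_imset (f := L)); last first.
  move=> g1 g2 /pffun_onP[/subsetP s1 _] /pffun_onP[/subsetP s2 _] eL.
  apply/ffunP=> B; have [BD|nBD] := boolP (B \in D); last first.
    have := contraNN (s1 B) nBD; have := contraNN (s2 B) nBD.
    by rewrite !supportE !negbK => /eqP-> /eqP->.
  move: BD; rewrite inE => /andP[BP _].
  have /and3P[_ _ n0] := valP p.
  have /set0Pn[x xinB] : B != finset.set0 by apply: contraNneq n0 => <-.
  by rewrite -(Bx x B) // -!Lx eL.
apply: eq_card => -[i j]; rewrite !inE /=.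
apply/andP/imsetP=> [[/delta_partP d1 /delta_partP d2] | [g /pffun_onP[/subsetP s _] [-> ->]]].
  pose g : {ffun {set points k l} -> 'I_N} := [ffun B =>
    if B \in D then (if [pick x in B] is Some x then label i j x else z) else z].
  have labc x y : same_block p x y -> pblock (blocks p) x \in D ->
      label i j x = label i j y.
    case: x y => x [y|y] s Dx.
    - exact: (d1 _ _ s).
    - by rewrite (negPf (thr _ _ s)) in Dx.
    - move: Dx; rewrite (eqP s) => Dx; rewrite same_block_sym in s.
      by rewrite (negPf (thr _ _ s)) in Dx.
    exact: (d2 _ _ s).
  have labz x : pblock (blocks p) x \notin D -> label i j x = z.
    rewrite inE mB /= negbK => /andP[/existsP[a ia] /existsP[b jb]].
    case: x ia jb => x; rewrite -!same_blockE => sa sb.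
      by have := d1 _ _ sb; rewrite /= ffunE.
    by have := d2 _ _ sa; rewrite /= ffunE.
  have gx x : g (pblock (blocks p) x) = label i j x.
    rewrite ffunE; case: ifPn => [Dx|/labz//].
    case: pickP => [y|/(_ x)]; last by rewrite xB.
    by rewrite -same_blockE => s; rewrite (labc x y).
  exists g.
    apply/pffun_onP; split=> [|//].
    apply/subsetP=> B; rewrite supportE; apply: contraR => nB.
    by rewrite ffunE ifN.
  by congr (_, _); apply/ffunP=> a; rewrite ffunE gx.
have gz B : B \notin D -> g B = z.
  by move/(contraNN (s B)); rewrite supportE negbK => /eqP.
have lab2 x y : same_block p x y -> g (pblock (blocks p) x) = g (pblock (blocks p) y).
  by move/eqP->.
split; apply/delta_partP=> -[a|a] [b|b] s' /=; rewrite !ffunE //.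
- exact: lab2 s'.
- exact/gz/thr/s'.
- by rewrite same_block_sym in s'; symmetry; apply/gz/thr/s'.
- by rewrite -(lab2 _ _ s'); symmetry; apply/gz/thr/s'.
- by rewrite (lab2 _ _ s'); rewrite same_block_sym in s'; apply/gz/thr/s'.
exact: lab2 s'.
Qed.

(** For projective [p] both factors in [card_outer_labels] are the number of
    middle labellings in [p p]. This is why the exponent [beta p / 2] makes [T_p]
    idempotent. *)
Lemma sqr_nb_middle N k (z : 'I_N) (p : part k k) : projective p ->
  (nb_middle z p p ^ 2)%N = (N ^ beta p)%N.
Proof.
move=> pp; rewrite -(card_outer_labels z p) -mulnn.
have sw (h : {ffun 'I_k -> 'I_N}) :
    delta_part p h [ffun=> z] = delta_part p [ffun=> z] h.
  by rewrite -{1}(projective_star pp) delta_star.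
by congr (_ * _)%N; apply: eq_card => h; rewrite !inE !sw andbb.
Qed.

Lemma sqrtC_exp_beta (K : numClosedFieldType) N k (p : part k k) :
  projective p ->
  sqrtC N.+1%:R ^+ beta p = (nb_middle (ord0 : 'I_N.+1) p p)%:R :> K.
Proof.
move=> pp; apply: (@pexpIrn _ 2); rewrite ?nnegrE ?exprn_ge0 ?sqrtC_ge0 ?ler0n //.
by rewrite -exprM mulnC exprM sqrtCK -!natrX sqr_nb_middle.
Qed.

Lemma sqrtC_exp_neq0 (K : numClosedFieldType) N n :
  sqrtC N.+1%:R ^- n != 0 :> K.
Proof. by rewrite invr_neq0 // expf_neq0 // sqrtC_eq0 pnatr_eq0. Qed.

Lemma Tpart_idem (K : numClosedFieldType) N k (p : part k k) : projective p ->
  Tpart K N.+1 p *m Tpart K N.+1 p = Tpart K N.+1 p.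
Proof.
move=> pp; rewrite /Tpart -scalemxAl -scalemxAr Tring_mul (projective_comp pp).
rewrite -sqrtC_exp_beta // [X in _ *: X]scalerA mulVf ?scale1r //.
by rewrite -invr_eq0 sqrtC_exp_neq0.
Qed.

Lemma Tpart_orthoproj (K : numClosedFieldType) N k (p : part k k) :
  projective p -> is_orthoproj (Tpart K N.+1 p).
Proof.
move=> pp; split; first exact: Tpart_idem.
rewrite -[adjmx _]/(ctr _) ctrZ ctr_Tring (projective_star pp); congr (_ *: _).
by rewrite geC0_conj // invr_ge0 exprn_ge0 // sqrtC_ge0 ler0n.
Qed.

(** A priori the composition is a multiple [c] of the map of [r]; idempotence of
    [T_p] gives [c ^ 2 = c]. *)
Lemma Tring_Tpart (K : numClosedFieldType) N k l (p : part k k) (r : part k l) :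
  projective p -> comp_part p r = r ->
  Tring K N.+1 r *m Tpart K N.+1 p = Tring K N.+1 r.
Proof.
move=> pp e; pose c : K := sqrtC N.+1%:R ^- beta p * (nb_middle (ord0 : 'I_N.+1) p r)%:R.
have eT : Tring K N.+1 r *m Tpart K N.+1 p = c *: Tring K N.+1 r.
  by rewrite -scalemxAr Tring_mul e scalerA.
have c0 : c != 0 by rewrite mulf_neq0 ?nb_middle_neq0 ?sqrtC_exp_neq0.
apply: (scalerI c0); rewrite scalemxAl -eT.
by rewrite -mulmxA (Tpart_idem K N pp).
Qed.

Lemma Tpart_Tring (K : numClosedFieldType) N k l (q : part l l) (r : part k l) :
  projective q -> comp_part r q = r ->
  Tpart K N.+1 q *m Tring K N.+1 r = Tring K N.+1 r.
Proof.
move=> pq e; apply: ctr_inj; rewrite ctr_mul ctr_Tring.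
have [_] := Tpart_orthoproj K N pq; rewrite -[adjmx _]/(ctr _) => ->.
by apply: Tring_Tpart; rewrite // -{1}(projective_star pq) -star_part_comp e.
Qed.

Lemma Tpart_mul_dominated (K : numClosedFieldType) N k (p q : part k k) :
  projective p -> projective q -> dominated q p ->
  Tpart K N.+1 p *m Tpart K N.+1 q = Tpart K N.+1 q.
Proof.
by move=> pp pq /eqP d; rewrite -[X in _ *m X]/(_ *: _) -scalemxAr Tpart_Tring.
Qed.

(** * A vector separating a noncrossing projective partition from smaller ones *)

Definition through_reps k (p : part k k) : {set 'I_k} :=
  [set a : 'I_k | same_block p (inl a) (inr a) &&
    [forall b : 'I_k, (b < a)%N ==> ~~ same_block p (inl a) (inl b)]]%SET.

Lemma through_reps_through k (p : part k k) a :
  a \in through_reps p -> same_block p (inl a) (inr a).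
Proof. by rewrite inE => /andP[]. Qed.

Lemma through_reps_inj k (p : part k k) a b :
  a \in through_reps p -> b \in through_reps p ->
  same_block p (inl a) (inl b) -> a = b.
Proof.
rewrite !inE => /andP[_ /forallP ma] /andP[_ /forallP mb] s; apply: val_inj.
have [lt|lt|//] := ltngtP a b.
  by have /implyP/(_ lt) := mb a; rewrite same_block_sym s.
by have /implyP/(_ lt) := ma b; rewrite s.
Qed.

Lemma through_reps_ex k (p : part k k) a : projective p ->
  same_block p (inl a) (inr a) ->
  exists2 b, b \in through_reps p & same_block p (inl a) (inl b).
Proof.
move=> pp t.
case: (arg_minnP (P := fun b => same_block p (inl a) (inl b)) (@nat_of_ord k)
  (same_block_refl p (inl a))) => b s mb.
exists b => //; rewrite inE; apply/andP; split.
  apply: (projective_through (m := a)) => //.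
  by apply: same_block_trans t; rewrite same_block_sym.
apply/forallP=> c; apply/implyP; rewrite ltnNge; apply: contraNN => sbc.
by apply: mb; apply: same_block_trans s sbc.
Qed.

(** In a noncrossing partition, look at two joined points of [S] that are as
    close as possible. Between them lies a point of [S] by the first hypothesis,
    and by the second it is joined to the lower row or to another point of [S]:
    either this produces a crossing or a closer pair. *)
Lemma noncrossing_separated k (S : {set 'I_k}) (q : part k k) :
  noncrossing q ->
  (forall a c : 'I_k, a \in S -> c \in S -> (a < c)%N ->
     same_block q (inl a) (inl c) -> exists2 b : 'I_k, b \in S & (a < b < c)%N) ->
  (forall b, b \in S -> (exists m, same_block q (inl b) (inr m)) \/
     exists d, [/\ d \in S, d != b & same_block q (inl b) (inl d)]) ->
  forall a c, a \in S -> c \in S -> same_block q (inl a) (inl c) -> a = c.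
Proof.
move=> nc gap part.
suff H n (a c : 'I_k) : (c - a < n)%N -> a \in S -> c \in S -> (a < c)%N ->
    ~~ same_block q (inl a) (inl c).
  move=> a c aS cS s; apply: val_inj; have [lt|lt|//] := ltngtP a c.
    by have := H _ a c (ltnSn _) aS cS lt; rewrite s.
  by have := H _ c a (ltnSn _) cS aS lt; rewrite same_block_sym s.
elim: n a c => // n IH a c; rewrite ltnS => le aS cS lt; apply/negP=> sac.
have [b bS /andP[ab bc]] := gap a c aS cS lt sac.
have nab : ~ same_block q (inl a) (inl b).
  by apply/negP/IH => //; apply: leq_trans le; rewrite ltn_sub2r.
case: (part b bS) => [[m sm]|[d [dS db sbd]]].
  apply: nab; apply: (nc (inl a) (inl b) (inl c) (inr m)) => //=.
  by rewrite (leq_trans (ltn_ord c)) ?leq_addr.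
have [lt_da|lt_ad|e] := ltngtP d a; last first.
- by apply: nab; rewrite same_block_sym -(val_inj e).
- have [lt_dc|lt_cd|e] := ltngtP d c; last first.
  + have e' := val_inj e; apply: nab; apply: same_block_trans sac _.
    by rewrite -e' same_block_sym.
  + by apply: nab; apply: (nc (inl a) (inl b) (inl c) (inl d)).
  have [lt_db|lt_bd|e] := ltngtP d b; last by rewrite (val_inj e) eqxx in db.
    have db_lt : (b - d < n)%N.
      apply: leq_trans le; apply: (@leq_ltn_trans (b - a)).
        by rewrite leq_sub2l // ltnW.
      by rewrite ltn_sub2r.
    by case/negP: (IH d b db_lt dS bS lt_db); rewrite same_block_sym.
  have bd_lt : (d - b < n)%N.
    apply: leq_trans le; apply: (@leq_ltn_trans (d - a)).
      by rewrite leq_sub2l // ltnW.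
    by rewrite ltn_sub2r.
  by case/negP: (IH b d bd_lt bS dS lt_bd).
have : same_block q (inl d) (inl a).
  apply: (nc (inl d) (inl a) (inl b) (inl c)) => //.
  by rewrite same_block_sym.
by move=> s; apply: nab; rewrite same_block_sym; apply: same_block_trans sbd s.
Qed.

(** A projective partition below [p] that keeps the through-blocks of [p]
    through and apart is [p] itself: it contains the blocks of [p] because
    [q = q p], and it cannot enlarge a non-through-block of [p], whose label is
    free. *)
Lemma dominated_eq k (p q : part k k) : projective p -> projective q ->
  dominated q p ->
  (forall a, a \in through_reps p -> same_block q (inl a) (inr a)) ->
  (forall a b, a \in through_reps p -> b \in through_reps p ->
     same_block q (inl a) (inl b) -> a = b) ->
  q = p.
Proof.
move=> pp pq dqp qthr qsep; have cpq := dominated_comp pp pq dqp.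
have sub a b : same_block p (inl a) (inl b) -> same_block q (inl a) (inl b).
  move=> s; apply/same_block_deltaP=> i j; rewrite -cpq.
  by case/delta_compP=> h /delta_partP d _; apply: d _ _ s.
have nthr a y : ~~ same_block p (inl a) (inr a) -> same_block q (inl a) y ->
    same_block p (inl a) y.
  move=> nt s.
  pose z0 : 'I_2 := ord0; pose z1 : 'I_2 := inord 1.
  pose f (x : points k k) := if same_block p (inl a) x then z1 else z0.
  have lf x : label [ffun c => f (inl c)] [ffun=> z0] x = f x.
    case: x => x; rewrite /= ffunE // /f; case: ifP => // t.
    by rewrite (projective_through pp t) in nt.
  have d : delta_part q [ffun c => f (inl c)] [ffun=> z0].
    rewrite -cpq; apply/delta_compP; exists [ffun=> z0]; last exact: delta_const.
    apply/delta_partP=> u v suv; rewrite !lf /f; congr (if _ then _ else _).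
    by apply/idP/idP=> t; apply: same_block_trans t _; rewrite // same_block_sym.
  move/same_block_deltaP: s => /(_ _ _ d); rewrite !lf /f same_block_refl.
  by case: ifP => // _ /(congr1 val); rewrite /= inordK.
have uu a b : same_block q (inl a) (inl b) = same_block p (inl a) (inl b).
  apply/idP/idP=> [s|]; last exact: sub.
  have [ta|/nthr] := boolP (same_block p (inl a) (inr a)); last exact.
  have [tb|/nthr] := boolP (same_block p (inl b) (inr b)); last first.
    by rewrite same_block_sym; apply; rewrite same_block_sym.
  have [c cS ac] := through_reps_ex pp ta.
  have [d dS bd] := through_reps_ex pp tb.
  have e : c = d.
    apply: qsep => //; apply: same_block_trans (sub _ _ bd).
    by apply: same_block_trans s; rewrite same_block_sym; apply: sub.
  by apply: same_block_trans ac _; rewrite e same_block_sym.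
have ul a b : same_block q (inl a) (inr b) = same_block p (inl a) (inr b).
  rewrite (projective_ul _ _ pq) (projective_ul _ _ pp) uu; congr (_ && _).
  apply/idP/idP=> [s|t].
    by apply: contraT => nt; case/negP: (nt); exact: (nthr _ _ nt s).
  have [c cS ac] := through_reps_ex pp t.
  apply: (projective_through (m := c)) => //.
  by apply: same_block_trans (sub _ _ ac) (qthr _ cS).
apply: partn_ext => -[a|a] [b|b].
- exact: uu.
- exact: ul.
- by rewrite same_block_sym ul same_block_sym.
by rewrite -(projective_swap _ _ pp) -(projective_swap _ _ pq) uu.
Qed.

Definition rep_parity k (p : part k k) (a : 'I_k) : bool :=
  odd #|[set b in through_reps p | (b < a)%N]%SET|.

Lemma rep_parity_next k (p : part k k) (a c : 'I_k) :
  a \in through_reps p -> (a < c)%N ->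
  (forall b : 'I_k, b \in through_reps p -> ~~ (a < b < c)%N) ->
  rep_parity p c = ~~ rep_parity p a.
Proof.
move=> aS ac gap; rewrite /rep_parity.
suff -> : [set b in through_reps p | (b < c)%N]%SET =
    (a |: [set b in through_reps p | (b < a)%N])%SET.
  by rewrite cardsU1 !inE ltnn andbF.
apply/setP=> b; rewrite in_setU1 [in LHS]inE [X in _ || X]inE.
have [->|nba] /= := eqVneq b a; first by rewrite aS ac.
have [bS|//] := boolP (b \in through_reps p); rewrite /=.
have := gap b bS; have [lt|lt|/val_inj e] := ltngtP b a => /=.
- by move=> _; apply: ltn_trans ac.
- by move/negPf.
by rewrite e eqxx in nba.
Qed.

(** The coefficients of e_0 - e_1 and of e_2 - e_3. *)
Definition alt_coef (K : numClosedFieldType) N (c : bool) (l : 'I_N) : K :=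
  (val l == c.*2)%:R - (val l == c.*2.+1)%:R.

Definition flip_label N (l : 'I_N.+4) : 'I_N.+4 :=
  inord (match val l with 0 => 1 | 1 => 0 | 2 => 3 | 3 => 2 | n => n end)%N.

Lemma val_flip_label N (l : 'I_N.+4) : val (flip_label l) =
  (match val l with 0 => 1 | 1 => 0 | 2 => 3 | 3 => 2 | n => n end)%N.
Proof. by rewrite /flip_label /= inordK //; case: l => -[|[|[|[|n]]]]. Qed.

Lemma flip_labelK N : involutive (@flip_label N).
Proof.
by move=> l; apply: val_inj; rewrite !val_flip_label; case: l => -[|[|[|[|n]]]].
Qed.

Lemma alt_coef_flip (K : numClosedFieldType) N c (l : 'I_N.+4) :
  alt_coef K c (flip_label l) = - alt_coef K c l.
Proof.
rewrite /alt_coef opprB val_flip_label.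
by case: l c => -[|[|[|[|n]]]] /= _ [] /=; rewrite ?subrr ?subr0 ?sub0r.
Qed.

Lemma alt_coef_disjoint (K : numClosedFieldType) N c (l : 'I_N) :
  alt_coef K c l != 0 -> alt_coef K (~~ c) l = 0.
Proof.
rewrite /alt_coef; case: l c => -[|[|[|[|n]]]] /= _ [] /=;
  by rewrite ?subrr ?eqxx ?subr0 ?sub0r.
Qed.

Definition alt_vector (K : numClosedFieldType) N k (p : part k k)
    (j : {ffun 'I_k -> 'I_N}) : K :=
  \prod_(a in through_reps p) alt_coef K (rep_parity p a) (j a).

(** The alternating product of the vectors e_0 - e_1 and e_2 - e_3, placed on
    the through-blocks of [p], vanishes when two neighbouring through-blocks
    carry the same label, and when it is summed over the label of a single
    through-block. A noncrossing [q] strictly below [p] must do one of the two. *)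
Lemma alt_vector_kill (K : numClosedFieldType) N k (p q : part k k)
    (i : {ffun 'I_k -> 'I_N.+4}) :
  projective p -> projective q -> noncrossing q -> sdominated q p ->
  \sum_(j : {ffun 'I_k -> 'I_N.+4}) (delta_part q j i)%:R * alt_vector K p j = 0.
Proof.
move=> pp pq nc /andP[dqp neq]; apply/eqP; apply: contraNT neq => s0.
have [j0 dj0 vj0] : exists2 j0 : {ffun 'I_k -> 'I_N.+4}, delta_part q j0 i &
    alt_vector K p j0 != 0.
  apply: contra_neqP s0 => nex; apply: big1 => j _.
  have [d|] := boolP (delta_part q j i); last by rewrite mul0r.
  have [->|v] := eqVneq (alt_vector K p j) 0; first by rewrite mulr0.
  by case: nex; exists j.
have gap (a c : 'I_k) : a \in through_reps p -> c \in through_reps p ->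
    (a < c)%N -> same_block q (inl a) (inl c) ->
    exists2 b : 'I_k, b \in through_reps p & (a < b < c)%N.
  move=> aS cS ac sac; apply/exists_inP; apply: contraT => /exists_inPn nex.
  have par := rep_parity_next aS ac nex.
  have /= e := delta_partP _ _ _ dj0 _ _ sac.
  move: vj0; rewrite /alt_vector (bigD1 a) //= mulf_eq0 negb_or.
  case/andP=> /alt_coef_disjoint va; rewrite (bigD1 c) /=; last first.
    by rewrite cS; apply: contraTneq ac => ->; rewrite ltnn.
  by rewrite par -e va mul0r eqxx.
have through_or_joined b : b \in through_reps p ->
    (exists m, same_block q (inl b) (inr m)) \/
    exists d, [/\ d \in through_reps p, d != b & same_block q (inl b) (inl d)].
  move=> bS.
  have [/existsP|/existsPn nt] := boolP [exists m, same_block q (inl b) (inr m)].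
    by left.
  have [/exists_inP[d dS /andP[? ?]]|/exists_inPn nj] :=
    boolP [exists (d | d \in through_reps p), (d != b) && same_block q (inl b) (inl d)].
    by right; exists d.
  (* Otherwise flipping the label of the block of [b] changes the sign of the
     sum. *)
  pose phi (j : {ffun 'I_k -> 'I_N.+4}) : {ffun 'I_k -> 'I_N.+4} :=
    [ffun y => if same_block q (inl b) (inl y) then flip_label (j y) else j y].
  have phiK : involutive phi.
    by move=> j; apply/ffunP=> y; rewrite !ffunE; case: same_block; rewrite ?flip_labelK.
  have lphi j x : label (phi j) i x =
      if same_block q (inl b) x then flip_label (label j i x) else label j i x.
    by case: x => x; rewrite /= ?ffunE // (negPf (nt x)).
  have dphi1 j : delta_part q j i -> delta_part q (phi j) i.
    move=> /delta_partP d; apply/delta_partP=> u v s; rewrite !lphi (d _ _ s).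
    congr (if _ then _ else _).
    by apply/idP/idP=> t; apply: same_block_trans t _; rewrite // same_block_sym.
  have dphi j : delta_part q (phi j) i = delta_part q j i.
    by apply/idP/idP=> /dphi1; rewrite ?phiK.
  have vphi j : alt_vector K p (phi j) = - alt_vector K p j.
    rewrite /alt_vector (bigD1 b) //= [in RHS](bigD1 b) //= ffunE same_block_refl.
    rewrite alt_coef_flip mulNr; congr (- (_ * _)).
    apply: eq_bigr => a /andP[aS ab]; rewrite ffunE.
    by have := nj a aS; rewrite ab /= => /negPf->.
  case/negP: s0; rewrite -[_ == 0](mulrn_eq0 _ 2) mulr2n.
  rewrite {1}(reindex_inj (inv_inj phiK)) /= -big_split big1 //= => j _.
  by rewrite dphi vphi mulrN addNr.
have sep := noncrossing_separated nc gap through_or_joined.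
apply/eqP/dominated_eq => // a aS.
case: (through_or_joined a aS) => [[m]|[d [dS da s]]].
  exact: projective_through.
by rewrite (sep _ _ aS dS s) eqxx in da.
Qed.

Lemma alt_vector_keep (K : numClosedFieldType) N k (p : part k k) :
  exists i : {ffun 'I_k -> 'I_N.+4},
  \sum_(j : {ffun 'I_k -> 'I_N.+4}) (delta_part p j i)%:R * alt_vector K p j != 0.
Proof.
pose f (x : points k k) : 'I_N.+4 := inord (odd #|[set b in through_reps p |
  [exists (a | a \in through_reps p), same_block p x (inl a) && (b < a)%N]]%SET|).*2.
pose i0 := [ffun a => f (inl a)] : {ffun 'I_k -> 'I_N.+4}.
pose j0 := [ffun a => f (inr a)] : {ffun 'I_k -> 'I_N.+4}.
have lf x : label i0 j0 x = f x by case: x => x; rewrite /= ffunE.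
have d0 : delta_part p i0 j0.
  apply/delta_partP=> x y s; rewrite !lf /f; congr (inord _.*2); congr (nat_of_bool (odd _)).
  apply: eq_card => b; rewrite !inE; congr (_ && _); apply: eq_existsb => a.
  by rewrite /same_block (eqP s).
have vi0 : alt_vector K p i0 = 1.
  apply: big1 => a aS; rewrite ffunE /f.
  have -> : [set b in through_reps p |
      [exists (a0 | a0 \in through_reps p), same_block p (inl a) (inl a0) && (b < a0)%N]]%SET =
      [set b in through_reps p | (b < a)%N]%SET.
    apply/setP=> b; rewrite [LHS]inE [RHS]inE; congr (_ && _).
    apply/exists_inP/idP=> [[c cS /andP[s lt]]|lt].
      by rewrite (through_reps_inj aS cS s).
    by exists a; rewrite // same_block_refl.
  rewrite -/(rep_parity p a) /alt_coef /= inordK; last by case: rep_parity.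
  by case: rep_parity; rewrite /= subr0.
exists j0; rewrite (eq_bigr (fun j => (delta_part p j j0)%:R : K)) => [|j _].
  rewrite -natr_sum pnatr_eq0 (bigD1 i0) //= d0.
  by rewrite add1n.
have [/delta_partP d|_] := boolP (delta_part p j j0); last by rewrite mul0r.
rewrite mul1r -vi0; apply: eq_bigr => a aS; congr (alt_coef K _ _).
have t := through_reps_through aS.
have := d _ _ t; have := delta_partP _ _ _ d0 _ _ t.
by move=> /= -> ->.
Qed.

Lemma exists_kernel_vector (K : numClosedFieldType) N k (p : part k k) :
  projective p ->
  exists xi : 'cV[K]_#|{: {ffun 'I_k -> 'I_N.+4}}|, Tring K N.+4 p *m xi != 0 /\
    forall q, projective q -> noncrossing q -> sdominated q p ->
      Tring K N.+4 q *m xi = 0.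
Proof.
move=> pp; pose xi : 'cV[K]_#|{: {ffun 'I_k -> 'I_N.+4}}| :=
  \col_a alt_vector K p (enum_val a).
have xiE (q : part k k) b : (Tring K N.+4 q *m xi) b ord0 =
    \sum_(j : {ffun 'I_k -> 'I_N.+4}) (delta_part q j (enum_val b))%:R * alt_vector K p j.
  by rewrite -sum_enum_val mxE; apply: eq_bigr => a _; rewrite !mxE.
exists xi; split=> [|q pq nc sd].
  case: (alt_vector_keep K N p) => i; apply: contraNneq => T0.
  by rewrite -(enum_rankK i) -xiE T0 mxE.
by apply/matrixP=> b c; rewrite ord1 xiE mxE alt_vector_kill.
Qed.

(** * The projections P_p *)

Lemma Hom_mul (K : numClosedFieldType) N (G : cmqg K N) m n p
    (u : 'M[coord G]_m) (v : 'M[coord G]_n) (w : 'M[coord G]_p) X Y :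
  Hom u v X -> Hom v w Y -> Hom u w (Y *m X).
Proof.
rewrite /Hom /scal_mx => eX eY; rewrite map_mxM -mulmxA eX mulmxA eY.
by rewrite mulmxA.
Qed.

Lemma Hom1 (K : numClosedFieldType) N (G : cmqg K N) n (v : 'M[coord G]_n) :
  Hom v v 1%:M.
Proof. by rewrite /Hom /scal_mx map_mx1 mul1mx mulmx1. Qed.

Lemma Tring_Hom (K : numClosedFieldType) N (G : cmqg K N.+1) C k l (p : part k l) :
  is_easy G C -> p \in C k l -> Hom (fund_pow G k) (fund_pow G l) (Tring K N.+1 p).
Proof.
move=> ez pC; apply/ez; have c0 := sqrtC_exp_neq0 K N (beta p).
rewrite -[Tring _ _ _](scalerK c0) -[_ *: Tring _ _ _]/(Tpart K N.+1 p) memvZ //.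
by apply: memv_span; apply/imageP; exists p.
Qed.

Lemma Hom_fund_pow_span (K : numClosedFieldType) N (G : cmqg K N.+1) C k l X :
  is_easy G C -> Hom (fund_pow G k) (fund_pow G l) X ->
  exists2 Y : part k l -> 'M[K]_(_, _),
    forall p, p \in C k l -> exists c, Y p = c *: Tring K N.+1 p &
    X = \sum_(p in C k l) Y p.
Proof.
move=> ez /ez; rewrite span_def big_map big_enum /=.
case/memv_sumP=> Y YT ->; exists Y => // p /YT /vlineP[c ->].
by exists (c * sqrtC N.+1%:R ^- beta p); rewrite -scalerA.
Qed.

Lemma Proj_cat C k (p : part k k) : p \in Proj C k -> p \in C k k.
Proof. by rewrite inE => /andP[]. Qed.

Lemma Proj_projective C k (p : part k k) : p \in Proj C k -> projective p.
Proof. by rewrite inE => /andP[]. Qed.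

Lemma R_part_correct (K : numClosedFieldType) N (G : cmqg K N.+1) C k
    (p : part k k) : is_easy G C ->
  is_orthoproj_sup (Hom (fund_pow G k) (fund_pow G k))
    (fun X => exists q, [/\ q \in Proj C k, sdominated q p & X = Tpart K N.+1 q])
    (R_part G C p) /\
  exists X, R_part G C p =
    (\sum_(q in Proj C k | sdominated q p) Tpart K N.+1 q) *m X.
Proof.
move=> ez.
apply: (@orthoproj_sup_correct K _ <<[seq Tpart K N.+1 r | r in C k k]>>%VS
  _ [pred q in Proj C k | sdominated q p]).
- exact: ez.
- by move=> X Y /ez XH /ez YH; apply/ez; apply: Hom_mul YH XH.
- exact/ez/Hom1.
- move=> q /andP[/Proj_cat qC _]; apply: memv_span.
  by apply/imageP; exists q.
- by move=> q /andP[/Proj_projective pq _]; apply: Tpart_orthoproj.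
by move=> X; split=> [[q [? ? ->]]|[q /andP[? ?] ->]]; exists q => //; apply/andP.
Qed.

Lemma P_part_facts (K : numClosedFieldType) N (G : cmqg K N.+1) C k
    (p : part k k) : is_easy G C -> p \in Proj C k ->
  let P := P_part G C p in
  [/\ Hom (fund_pow G k) (fund_pow G k) P, P *m P = P, ctr P = P,
      Tpart K N.+1 p *m P = P &
      forall q, q \in Proj C k -> sdominated q p -> Tpart K N.+1 q *m P = 0].
Proof.
move=> ez pC /=; have pp := Proj_projective pC.
have [[RM [RR Rh] le _] [X eR]] := R_part_correct p ez.
rewrite -[adjmx _]/(ctr _) in Rh; rewrite /P_part; set R := R_part G C p in RM RR Rh le eR *.
have [TT Th] := Tpart_orthoproj K N pp; rewrite -[adjmx _]/(ctr _) in Th.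
set T := Tpart K N.+1 p in TT Th *.
have TR : T *m R = R.
  rewrite eR mulmxA mulmx_sumr; congr (_ *m X); apply: eq_bigr => q /andP[qC /andP[dq _]].
  exact: Tpart_mul_dominated (Proj_projective qC) dq.
have RT : R *m T = R by rewrite -Rh -[in RHS]TR ctr_mul Th.
have ph : ctr (T - R) = T - R by rewrite ctrB Th Rh.
split=> //.
- have TH : Hom (fund_pow G k) (fund_pow G k) T.
    apply/ez; apply: memv_span; apply/imageP; exists p => //; exact: Proj_cat pC.
  by apply/ez; rewrite memvB //; apply/ez.
- by rewrite mulmxBl !mulmxBr TT TR RT RR subrr subr0.
- by rewrite mulmxBr TT TR.
move=> q qC sq; have pq := Proj_projective qC.
have [_ qh] := Tpart_orthoproj K N pq; rewrite -[adjmx _]/(ctr _) in qh.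
apply: ctr_inj; rewrite ctr_mul ctr0 ph qh mulmxBl.
rewrite (Tpart_mul_dominated K N pp pq); last by case/andP: sq.
rewrite (le (Tpart K N.+1 q)) ?subrr //; exists q; split=> //.
Qed.

(** The vector of [exists_kernel_vector] is orthogonal to the ranges of all the
    [T_q] spanning the range of [R_p], but not to the range of [T_p]. *)
Lemma P_part_neq0 (K : numClosedFieldType) N (G : cmqg K N.+4) C k
    (p : part k k) : is_noncrossing_category C -> is_easy G C ->
  p \in Proj C k -> P_part G C p != 0.
Proof.
move=> [catC ncC] ez pC; have pp := Proj_projective pC.
have [[_ [_ Rh] _ _] [X eR]] := R_part_correct p ez.
have [xi [xi0 kill]] := exists_kernel_vector K N pp.
apply: contra_neq xi0 => P0.
have eT : Tpart K N.+4 p = R_part G C p.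
  by apply/eqP; rewrite -subr_eq0; apply/eqP.
have c0 := sqrtC_exp_neq0 K N.+3 (beta p).
apply: (scalerI c0); rewrite scaler0 scalemxAl -/(Tpart K N.+4 p) eT.
rewrite -Rh -[adjmx _]/(ctr _) eR ctr_mul -mulmxA.
suff -> : ctr (\sum_(q in Proj C k | sdominated q p) Tpart K N.+4 q) *m xi = 0.
  by rewrite mulmx0.
rewrite /ctr raddf_sum map_mx_sum mulmx_suml big1 // => q /andP[qC sq].
have pq := Proj_projective qC.
have [_ /= qh] := Tpart_orthoproj K N.+3 pq; rewrite /adjmx in qh.
rewrite qh -scalemxAl kill ?scaler0 //.
exact: ncC (Proj_cat qC).
Qed.

(** If [r p = r], the initial projection [r^* r] of [r] is dominated by [p]; when
    it is not [p], its map is killed by [P_p], and so is the map of [r]. *)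
Lemma Tring_P_part_eq0 (K : numClosedFieldType) N (G : cmqg K N.+1) C k l
    (p : part k k) (r : part k l) :
  is_category C -> is_easy G C -> p \in Proj C k -> r \in C k l ->
  comp_part p r = r -> comp_part r (star_part r) != p ->
  Tring K N.+1 r *m P_part G C p = 0.
Proof.
move=> catC ez pC rC pr neq; have pp := Proj_projective pC.
have p'C := Proj_comp_star catC rC; have pp' := Proj_projective p'C.
rewrite -(Tring_Tpart K N pp' (comp_part_star_self r)) -mulmxA.
have [_ _ _ _ ->] := P_part_facts ez pC; rewrite ?mulmx0 ?p'C //.
rewrite /sdominated neq andbT /dominated comp_partA.
by rewrite -{1}(projective_star pp) -star_part_comp pr.
Qed.

Lemma P_part_Tring_eq0 (K : numClosedFieldType) N (G : cmqg K N.+1) C k l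
    (q : part l l) (r : part k l) :
  is_category C -> is_easy G C -> q \in Proj C l -> r \in C k l ->
  comp_part r q = r -> comp_part (star_part r) r != q ->
  P_part G C q *m Tring K N.+1 r = 0.
Proof.
move=> catC ez qC rC rq neq; apply: ctr_inj; rewrite ctr_mul ctr_Tring ctr0.
have [_ _ -> _ _] := P_part_facts ez qC.
have qr : comp_part q (star_part r) = star_part r.
  by rewrite -{1}(projective_star (Proj_projective qC)) -star_part_comp rq.
have neq' : comp_part (star_part r) (star_part (star_part r)) != q.
  by rewrite star_partK.
exact: Tring_P_part_eq0 catC ez qC (cat_star catC rC) qr neq'.
Qed.

(** Between [P_p] and [P_q] only those [r] survive that implement an
    equivalence of [p] and [q]. *)
Lemma P_part_sandwich (K : numClosedFieldType) N (G : cmqg K N.+1) C k l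
    (p : part k k) (q : part l l) (r : part k l) :
  is_category C -> is_easy G C -> p \in Proj C k -> q \in Proj C l ->
  r \in C k l -> P_part G C q *m Tring K N.+1 r *m P_part G C p != 0 ->
  exists r', [/\ r' \in C k l, comp_part r' (star_part r') = p,
    comp_part (star_part r') r' = q & exists c,
    P_part G C q *m Tring K N.+1 r *m P_part G C p =
    c *: (P_part G C q *m Tring K N.+1 r' *m P_part G C p)].
Proof.
move=> catC ez pC qC rC nz.
have pp := Proj_projective pC; have pq := Proj_projective qC.
pose r' := comp_part (comp_part p r) q.
have r'C : r' \in C k l.
  exact: cat_comp catC _ _ _ _ _ (cat_comp catC (Proj_cat pC) rC) (Proj_cat qC).
have [_ _ _ pP _] := P_part_facts ez pC.
have [_ _ qh qP _] := P_part_facts ez qC.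
have Pq : P_part G C q *m Tpart K N.+1 q = P_part G C q.
  apply: ctr_inj; rewrite ctr_mul qh.
  by have [_] := Tpart_orthoproj K N pq; rewrite -[adjmx _]/(ctr _) => ->.
have [c ec] : exists c,
    Tpart K N.+1 q *m Tring K N.+1 r *m Tpart K N.+1 p = c *: Tring K N.+1 r'.
  rewrite /Tpart -!scalemxAl -!scalemxAr -!mulmxA Tring_mul -scalemxAr Tring_mul.
  by rewrite !scalerA; eexists.
have e : P_part G C q *m Tring K N.+1 r *m P_part G C p =
    c *: (P_part G C q *m Tring K N.+1 r' *m P_part G C p).
  by rewrite -{1}Pq -{1}pP scalemxAl scalemxAr -ec !mulmxA.
have pr' : comp_part p r' = r' by rewrite /r' -!comp_partA (projective_comp pp).
have r'q : comp_part r' q = r' by rewrite /r' comp_partA (projective_comp pq).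
exists r'; split; [exact: r'C | | | by exists c].
  apply/eqP; apply: contraNT nz => neq.
  by rewrite e -mulmxA (Tring_P_part_eq0 catC ez pC r'C pr' neq) mulmx0 scaler0.
apply/eqP; apply: contraNT nz => neq.
by rewrite e (P_part_Tring_eq0 catC ez qC r'C r'q neq) mul0mx scaler0.
Qed.

Lemma P_part_endo (K : numClosedFieldType) N (G : cmqg K N.+1) C k
    (p : part k k) X :
  is_noncrossing_category C -> is_easy G C -> p \in Proj C k ->
  Hom (fund_pow G k) (fund_pow G k) X ->
  exists c, P_part G C p *m X *m P_part G C p = c *: P_part G C p.
Proof.
move=> [catC ncC] ez pC /(Hom_fund_pow_span ez)[Y YT ->].
have [_ PP _ pP _] := P_part_facts ez pC.
apply/vlineP; rewrite mulmx_sumr mulmx_suml memv_suml // => r rC.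
have [c ->] := YT r rC; rewrite -scalemxAr -scalemxAl memvZ //.
have [->|nz] := eqVneq (P_part G C p *m Tring K N.+1 r *m P_part G C p) 0.
  exact: mem0v.
have [r' [r'C e1 e2 [c' ->]]] := P_part_sandwich catC ez pC pC rC nz.
rewrite memvZ // (noncrossing_unitary (ncC _ _ _ r'C) e1 e2).
have c0 := sqrtC_exp_neq0 K N (beta p).
rewrite -[Tring _ _ _](scalerK c0) -[_ *: Tring _ _ _]/(Tpart K N.+1 p).
by rewrite -scalemxAr -scalemxAl -mulmxA pP PP memvZ // memv_line.
Qed.

Lemma P_part_hom (K : numClosedFieldType) N (G : cmqg K N.+1) C k l
    (p : part k k) (q : part l l) X :
  is_category C -> is_easy G C -> p \in Proj C k -> q \in Proj C l ->
  Hom (fund_pow G k) (fund_pow G l) X ->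
  P_part G C q *m X *m P_part G C p != 0 -> equiv_part C p q.
Proof.
move=> catC ez pC qC /(Hom_fund_pow_span ez)[Y YT ->].
rewrite mulmx_sumr mulmx_suml => nz; apply: contra_neqP nz => neq.
apply: big1 => r rC; have [c ->] := YT r rC.
rewrite -scalemxAr -scalemxAl; apply/eqP; apply: contraT => nz; case: neq.
have [|r' [r'C e1 e2 _]] := P_part_sandwich catC ez pC qC rC.
  by apply: contraNneq nz => ->; rewrite scaler0.
by exists r'.
Qed.

(** For [p'] strictly below [p], let [s] be [r p']. Then [s s^*] is strictly below
    [q], since [p'] can be recovered from it as [r^* s s^* r]; so [R_q] fixes the
    map of [s]. *)
Lemma R_part_Tring (K : numClosedFieldType) N (G : cmqg K N.+1) C k l
    (p : part k k) (q : part l l) (r : part k l) :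
  is_category C -> is_easy G C -> p \in Proj C k -> q \in Proj C l ->
  r \in C k l -> comp_part r (star_part r) = p ->
  comp_part (star_part r) r = q ->
  R_part G C q *m Tring K N.+1 r *m R_part G C p =
  Tring K N.+1 r *m R_part G C p.
Proof.
move=> catC ez pC qC rC e1 e2; have [_ [X ->]] := R_part_correct p ez.
rewrite !mulmxA !mulmx_sumr; congr (_ *m X); apply: eq_bigr => p' /andP[p'C /andP[dp' neq]].
have pp' := Proj_projective p'C; have pp := Proj_projective pC.
pose s := comp_part p' r.
have sC : s \in C k l := cat_comp catC (Proj_cat p'C) rC.
have q'C : comp_part (star_part s) s \in Proj C l.
  by rewrite -{2}(star_partK s); exact: Proj_comp_star catC (cat_star catC sC).
have pq' := Proj_projective q'C.
have rq : comp_part r q = r by rewrite -e2 -comp_partA comp_part_star_self.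
have sq : comp_part s q = s by rewrite /s comp_partA rq.
have sq' : comp_part s (comp_part (star_part s) s) = s.
  by rewrite -comp_partA comp_part_star_self.
have sdq : sdominated (comp_part (star_part s) s) q.
  rewrite /sdominated /dominated comp_partA sq eqxx /=.
  apply: contraNneq neq => e; rewrite eq_sym -{1}e1.
  have : comp_part r (comp_part q (star_part r)) = p.
    by rewrite -comp_partA rq.
  rewrite -e /s star_part_comp (projective_star pp') => e'.
  apply/eqP; rewrite e1 -e' !comp_partA -(comp_partA p' p') (projective_comp pp').
  rewrite -!comp_partA e1 comp_partA e1 (dominated_comp pp pp' dp').
  exact: eqP dp'.
have [[_ _ le _] _] := R_part_correct q ez.
have e : Tring K N.+1 r *m Tpart K N.+1 p' =
    sqrtC N.+1%:R ^- beta p' *: ((nb_middle (ord0 : 'I_N.+1) p' r)%:R *: Tring K N.+1 s).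
  by rewrite -scalemxAr Tring_mul.
rewrite -[LHS]mulmxA e -!scalemxAr; do 2 congr (_ *: _).
rewrite -(Tpart_Tring K N pq' sq') mulmxA (le (Tpart K N.+1 _)) => [//|].
by exists (comp_part (star_part s) s).
Qed.

(** The map of [r] carries the range of [R_p] into that of [R_q], and its adjoint
    goes back; so it intertwines [R_p] and [R_q]. *)
Lemma P_part_Tring (K : numClosedFieldType) N (G : cmqg K N.+1) C k l
    (p : part k k) (q : part l l) (r : part k l) :
  is_category C -> is_easy G C -> p \in Proj C k -> q \in Proj C l ->
  r \in C k l -> comp_part r (star_part r) = p ->
  comp_part (star_part r) r = q ->
  P_part G C q *m Tring K N.+1 r = Tring K N.+1 r *m P_part G C p.
Proof.
move=> catC ez pC qC rC e1 e2.
have pp := Proj_projective pC; have pq := Proj_projective qC.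
have E1 := R_part_Tring catC ez pC qC rC e1 e2.
have := R_part_Tring (r := star_part r) catC ez qC pC (cat_star catC rC).
rewrite star_partK => /(_ e2 e1)/(congr1 (@ctr _ _ _)).
have [[_ [_ Rph] _ _] _] := R_part_correct p ez.
have [[_ [_ Rqh] _ _] _] := R_part_correct q ez.
rewrite -[adjmx _]/(ctr _) in Rph; rewrite -[adjmx _]/(ctr _) in Rqh.
rewrite !ctr_mul ctr_Tring star_partK Rph Rqh mulmxA E1 => E2.
have pr : comp_part p r = r by rewrite -e1 comp_part_star_self.
have rq : comp_part r q = r by rewrite -e2 -comp_partA comp_part_star_self.
by rewrite /P_part mulmxBl mulmxBr E2 (Tpart_Tring K N pq rq) (Tring_Tpart K N pp pr).
Qed.

Lemma ctr_Tring_mul (K : numClosedFieldType) N k l (p : part k k) (r : part k l) :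
  comp_part r (star_part r) = p ->
  exists2 c : K, c != 0 &
    Tring K N.+1 (star_part r) *m Tring K N.+1 r = c *: Tpart K N.+1 p.
Proof.
move=> e; rewrite Tring_mul e.
have c0 := sqrtC_exp_neq0 K N (beta p).
exists ((nb_middle (ord0 : 'I_N.+1) r (star_part r))%:R / sqrtC N.+1%:R ^- beta p).
  by apply: mulf_neq0; [apply: nb_middle_neq0 | apply: invr_neq0].
by rewrite -[RHS]scalerA scalerK.
Qed.

(** * Matrices over the coordinate algebra *)

Lemma scal_mxM (K : numClosedFieldType) N (G : cmqg K N) m n p
    (X : 'M[K]_(m, n)) (Y : 'M_(n, p)) :
  scal_mx G (X *m Y) = scal_mx G X *m scal_mx G Y.
Proof. exact: map_mxM. Qed.

Lemma scal_mx1 (K : numClosedFieldType) N (G : cmqg K N) n :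
  scal_mx G (1%:M : 'M[K]_n) = 1%:M.
Proof. exact: map_mx1. Qed.

Lemma scal_mx0 (K : numClosedFieldType) N (G : cmqg K N) m n :
  scal_mx G (0 : 'M[K]_(m, n)) = 0.
Proof. exact: map_mx0. Qed.

Lemma scal_mxB (K : numClosedFieldType) N (G : cmqg K N) m n (X Y : 'M[K]_(m, n)) :
  scal_mx G (X - Y) = scal_mx G X - scal_mx G Y.
Proof. exact: map_mxB. Qed.

Lemma star_sum (K : numClosedFieldType) (A : star_algebra K) (I : finType)
    (F : I -> A) : star (\sum_i F i) = \sum_i star (F i).
Proof.
apply: (big_morph (@star K A) (@starD K A)).
by have := starD (0 : A) 0; rewrite addr0 => /esym/eqP; rewrite -subr_eq0 addrK => /eqP.
Qed.

Lemma star1 (K : numClosedFieldType) (A : star_algebra K) : star (1 : A) = 1.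
Proof. by rewrite -[LHS]mulr1 -{2}[1](@starK K A) -starM mulr1 starK. Qed.

Definition star_mx (K : numClosedFieldType) (A : star_algebra K) m n
    (v : 'M[A]_(m, n)) : 'M[A]_(n, m) := map_mx (@star K A) v^T.

Lemma star_mxE (K : numClosedFieldType) (A : star_algebra K) m n
    (v : 'M[A]_(m, n)) i j : star_mx v i j = star (v j i).
Proof. by rewrite !mxE. Qed.

Lemma star_mxM (K : numClosedFieldType) (A : star_algebra K) m n p
    (v : 'M[A]_(m, n)) (w : 'M_(n, p)) :
  star_mx (v *m w) = star_mx w *m star_mx v.
Proof.
apply/matrixP=> i j; rewrite !mxE star_sum; apply: eq_bigr => h _.
by rewrite !mxE starM.
Qed.

Lemma star_mxK (K : numClosedFieldType) (A : star_algebra K) m n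
    (v : 'M[A]_(m, n)) : star_mx (star_mx v) = v.
Proof. by apply/matrixP=> i j; rewrite !mxE starK. Qed.

Lemma star_mx_scal (K : numClosedFieldType) N (G : cmqg K N) m n
    (X : 'M[K]_(m, n)) : star_mx (scal_mx G X) = scal_mx G (ctr X).
Proof. by apply/matrixP=> i j; rewrite !mxE /= starZ star1. Qed.

Definition comultiplicative (K : numClosedFieldType) N (G : cmqg K N) n
    (v : 'M[coord G]_n) : Prop :=
  map_mx (comult G) v = map_mx (coord2l G) v *m map_mx (coord2r G) v.

Lemma comultiplicativeP (K : numClosedFieldType) N (G : cmqg K N) n
    (v : 'M[coord G]_n) :
  comultiplicative v <-> forall i j,
    comult G (v i j) = \sum_h coord2l G (v i h) * coord2r G (v h j).
Proof.
split=> [/matrixP e i j|e]; last first.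
  by apply/matrixP=> i j; rewrite !mxE e; apply: eq_bigr => h _; rewrite !mxE.
by have := e i j; rewrite !mxE => ->; apply: eq_bigr => h _; rewrite !mxE.
Qed.

Lemma map_scal_mx (K : numClosedFieldType) N (G : cmqg K N) m n
    (B : star_algebra K) (f : {lrmorphism coord G -> B}) (X : 'M[K]_(m, n)) :
  map_mx f (scal_mx G X) = map_mx (in_alg B) X.
Proof. by apply/matrixP=> i j; rewrite !mxE /= linearZ rmorph1. Qed.

(** * Subrepresentations cut out by idempotents *)

Lemma row_base_col_base (K : fieldType) n (P : 'M[K]_n) : P *m P = P ->
  row_base P *m col_base P = 1%:M.
Proof.
move=> PP; have fb := row_base_free P; have cb := col_base_full P.
apply: (row_free_inj fb); apply: (row_full_inj cb).
by rewrite mul1mx -(mulmxA (row_base P)) mulmx_base mulmxA mulmx_base PP.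
Qed.

Lemma idem_col_base (K : fieldType) n (P : 'M[K]_n) : P *m P = P ->
  P *m col_base P = col_base P.
Proof.
move=> PP; transitivity (col_base P *m row_base P *m col_base P).
  by rewrite mulmx_base.
by rewrite -mulmxA (row_base_col_base PP) mulmx1.
Qed.

Lemma row_base_idem (K : fieldType) n (P : 'M[K]_n) : P *m P = P ->
  row_base P *m P = row_base P.
Proof.
move=> PP; transitivity (row_base P *m (col_base P *m row_base P)).
  by rewrite mulmx_base.
by rewrite mulmxA (row_base_col_base PP) mul1mx.
Qed.

(** The compression of [v'] inverts the compression of [v] because the range of
    [P] is invariant under both. *)
Lemma sub_rep_invariant (K : numClosedFieldType) N (G : cmqg K N) n
    (v v' : 'M[coord G]_n) (P : 'M[K]_n) :
  comultiplicative v -> v *m v' = 1%:M -> v' *m v = 1%:M -> P *m P = P ->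
  v *m scal_mx G P = scal_mx G P *m v *m scal_mx G P ->
  v' *m scal_mx G P = scal_mx G P *m v' *m scal_mx G P ->
  is_rep (sub_rep v P) /\ Hom (sub_rep v P) v (col_base P).
Proof.
move=> cv vv' v'v PP iv iv'; set s := scal_mx G in iv iv' *.
have sE : s _ _ (col_base P) *m s _ _ (row_base P) = s _ _ P.
  by rewrite -scal_mxM mulmx_base.
have sPE : s _ _ P *m s _ _ (col_base P) = s _ _ (col_base P).
  by rewrite -scal_mxM idem_col_base.
have sLE : s _ _ (row_base P) *m s _ _ (col_base P) = 1%:M.
  by rewrite -scal_mxM row_base_col_base // scal_mx1.
have ivE x : x *m s _ _ P = s _ _ P *m x *m s _ _ P ->
    x *m s _ _ (col_base P) = s _ _ P *m x *m s _ _ (col_base P).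
  by move=> e; rewrite -sPE !mulmxA e.
have inv x y : y *m s _ _ P = s _ _ P *m y *m s _ _ P -> x *m y = 1%:M ->
    s _ _ (row_base P) *m x *m s _ _ (col_base P) *m
    (s _ _ (row_base P) *m y *m s _ _ (col_base P)) = 1%:M.
  move=> e xy; rewrite -!mulmxA (mulmxA (s _ _ (col_base P))) sE.
  by rewrite (mulmxA (s _ _ P)) -ivE // (mulmxA x) xy mul1mx.
split; last first.
  rewrite /Hom /sub_rep -/s; apply/esym.
  by rewrite ivE // !mulmxA sE.
split; last first.
  exists (s _ _ (row_base P) *m v' *m s _ _ (col_base P)).
  by split; apply: inv.
apply/comultiplicativeP; move: (ivE _ iv) (mulmx_base P).
rewrite /comultiplicative /sub_rep -/s {inv ivE sE sPE sLE}.
move: (col_base P) (row_base P) => E L eE eP.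
rewrite !map_mxM !map_scal_mx cv; move/(congr1 (map_mx (coord2r G))): eE.
rewrite !map_mxM !map_scal_mx.
set r := map_mx (coord2r G) v; set l := map_mx (coord2l G) v => er.
rewrite -!mulmxA; congr (_ *m (_ *m _)).
by rewrite mulmxA -map_mxM eP mulmxA -er.
Qed.

Lemma sub_rep_endo (K : numClosedFieldType) N (G : cmqg K N) n
    (v : 'M[coord G]_n) (P : 'M[K]_n) :
  is_rep v -> P *m P = P -> Hom v v P ->
  is_rep (sub_rep v P) /\ Hom (sub_rep v P) v (col_base P).
Proof.
case=> /comultiplicativeP cv [v' [v'v vv']] PP HP.
have HP' : scal_mx G P *m v' = v' *m scal_mx G P.
  by rewrite -[LHS]mul1mx -v'v -mulmxA (mulmxA v) -HP -!mulmxA vv' mulmx1.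
apply: (sub_rep_invariant cv vv' v'v PP).
  by rewrite HP -mulmxA -scal_mxM PP.
by rewrite HP' -mulmxA -scal_mxM PP.
Qed.

Lemma Hom_row_base (K : numClosedFieldType) N (G : cmqg K N) n
    (v : 'M[coord G]_n) (P : 'M[K]_n) :
  P *m P = P -> Hom v v P -> Hom v (sub_rep v P) (row_base P).
Proof.
move=> PP HP; rewrite /Hom /sub_rep -[RHS]mulmxA -scal_mxM mulmx_base.
by rewrite -mulmxA -HP mulmxA -scal_mxM row_base_idem.
Qed.

(** The kernel of an intertwiner out of an irreducible representation is a
    subrepresentation, hence zero. *)
Lemma irreducible_inj (K : numClosedFieldType) N (G : cmqg K N) m n
    (v : 'M[coord G]_n) (w : 'M[coord G]_m) (S : 'M[K]_(m, n)) :
  irreducible_rep v -> is_rep w -> Hom v w S -> S != 0 -> \rank S = n.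
Proof.
case=> -[/comultiplicativeP cv [v' [v'v vv']]] n0 irr [_ [w' [w'w ww']]] HS S0.
have HS' : scal_mx G S *m v' = w' *m scal_mx G S.
  by rewrite -[LHS]mul1mx -w'w -mulmxA (mulmxA w) -HS -!mulmxA vv' mulmx1.
pose P := 1%:M - pinvmx S *m S.
have SP : S *m P = 0 by rewrite mulmxBr mulmx1 mulmxA mulmxKpV ?subrr.
have PP : P *m P = P by rewrite {1}/P mulmxBl mul1mx -mulmxA SP mulmx0 subr0.
have inv x y : scal_mx G S *m x = y *m scal_mx G S ->
    x *m scal_mx G P = scal_mx G P *m x *m scal_mx G P.
  move=> e; have -> : scal_mx G P *m x = x - scal_mx G (pinvmx S) *m (y *m scal_mx G S).
    by rewrite scal_mxB scal_mx1 mulmxBl mul1mx scal_mxM -e mulmxA.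
  by rewrite mulmxBl -!mulmxA -scal_mxM SP scal_mx0 !mulmx0 subr0.
have [rP HE] := sub_rep_invariant cv vv' v'v PP (inv _ _ HS) (inv _ _ HS').
have rE : \rank (col_base P) = \rank P.
  by apply/eqP; exact: col_base_full P.
case: (irr _ _ _ rP HE rE) => [r0|rn].
  have P0 : P = 0 by apply/eqP; rewrite -mxrank_eq0 r0.
  apply/eqP; rewrite eqn_leq rank_leq_col /=.
  have e1 : pinvmx S *m S = 1%:M by apply/eqP; rewrite eq_sym -subr_eq0 -/P P0.
  by rewrite -{1}(mxrank1 K n) -e1 mxrankM_maxr.
case/eqP: S0; have fP : row_free P by rewrite /row_free rn.
by apply: (row_free_inj fP); rewrite SP mul0mx.
Qed.

(** * Unitarity and complete reducibility of the tensor powers *)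

Definition cons_index N k (a : 'I_N) (f : {ffun 'I_k -> 'I_N}) :
    {ffun 'I_k.+1 -> 'I_N} :=
  [ffun i => if unlift ord0 i is Some j then f j else a].

Lemma cons_index0 N k (a : 'I_N) (f : {ffun 'I_k -> 'I_N}) :
  cons_index a f ord0 = a.
Proof. by rewrite ffunE unlift_none. Qed.

Lemma cons_indexS N k (a : 'I_N) (f : {ffun 'I_k -> 'I_N}) i :
  cons_index a f (lift ord0 i) = f i.
Proof. by rewrite ffunE liftK. Qed.

Lemma cons_index_eta N k (f : {ffun 'I_k.+1 -> 'I_N}) :
  cons_index (f ord0) [ffun i => f (lift ord0 i)] = f.
Proof.
apply/ffunP=> i; rewrite ffunE; case: unliftP => [j ->|-> //].
by rewrite ffunE.
Qed.

Lemma sum_cons_index (V : nmodType) N k (F : {ffun 'I_k.+1 -> 'I_N} -> V) :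
  \sum_f F f = \sum_a \sum_f F (cons_index a f).
Proof.
rewrite pair_big /=.
rewrite (reindex (fun x : 'I_N * {ffun 'I_k -> 'I_N} => cons_index x.1 x.2)) //=.
exists (fun f => (f ord0, [ffun i => f (lift ord0 i)])) => [[a f]|f] _ /=.
  rewrite cons_index0; congr (_, _); apply/ffunP=> i.
  by rewrite ffunE cons_indexS.
exact: cons_index_eta.
Qed.

Lemma cons_index_eq N k (b c : 'I_N) (f g : {ffun 'I_k -> 'I_N}) :
  (cons_index b f == cons_index c g) = (b == c) && (f == g).
Proof.
apply/eqP/andP=> [e|[/eqP-> /eqP->] //]; split; apply/eqP.
  by have := congr1 (fun h : {ffun _} => h ord0) e; rewrite !cons_index0.
apply/ffunP=> i; have := congr1 (fun h : {ffun _} => h (lift ord0 i)) e.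
by rewrite !cons_indexS.
Qed.

Definition fund_monomial (K : numClosedFieldType) N (G : cmqg K N) k
    (b c : {ffun 'I_k -> 'I_N}) : coord G := \prod_(s < k) fund G (b s) (c s).

Lemma fund_monomialS (K : numClosedFieldType) N (G : cmqg K N) k a a'
    (b c : {ffun 'I_k -> 'I_N}) :
  fund_monomial G (cons_index a b) (cons_index a' c) =
  fund G a a' * fund_monomial G b c.
Proof.
rewrite /fund_monomial big_ord_recl !cons_index0; congr (_ * _).
by apply: eq_bigr => s _; rewrite !cons_indexS.
Qed.

Lemma fund_monomial0 (K : numClosedFieldType) N (G : cmqg K N)
    (b c : {ffun 'I_0 -> 'I_N}) : fund_monomial G b c = 1.
Proof. by rewrite /fund_monomial big_ord0. Qed.

Lemma sum_ffun0 (V : nmodType) N (F : {ffun 'I_0 -> 'I_N} -> V) b :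
  \sum_f F f = F b.
Proof.
rewrite (bigD1 b) //= big1 ?addr0 // => f /eqP nf.
by case: nf; apply/ffunP=> -[].
Qed.

Lemma fund_monomial_orthol (K : numClosedFieldType) N (G : cmqg K N) k
    (b c : {ffun 'I_k -> 'I_N}) :
  \sum_h star (fund_monomial G h b) * fund_monomial G h c = (b == c)%:R.
Proof.
elim: k b c => [|k IH] b c.
  have -> : b == c by apply/eqP/ffunP=> -[].
  by rewrite (sum_ffun0 _ b) !fund_monomial0 star1 mulr1.
rewrite -(cons_index_eta b) -(cons_index_eta c); move: (b ord0) (c ord0) => b0 c0.
set b' := [ffun _ => _]; set c' := [ffun _ => _].
have e : \sum_a fund G a b0 * fund G a c0 = (b0 == c0)%:R.
  have /matrixP/(_ b0 c0) := fund_orthol G; rewrite !mxE => <-.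
  by apply: eq_bigr => a _; rewrite !mxE.
transitivity (\sum_f star (fund_monomial G f b') * (b0 == c0)%:R * fund_monomial G f c').
  rewrite sum_cons_index exchange_big; apply: eq_bigr => f _.
  rewrite -e mulr_sumr mulr_suml; apply: eq_bigr => a _.
  by rewrite !fund_monomialS starM fund_star !mulrA.
rewrite cons_index_eq; case: (b0 == c0) => /=.
  by rewrite -IH; apply: eq_bigr => f _; rewrite mulr1.
by rewrite big1 // => f _; rewrite mulr0 mul0r.
Qed.

Lemma fund_monomial_orthor (K : numClosedFieldType) N (G : cmqg K N) k
    (b c : {ffun 'I_k -> 'I_N}) :
  \sum_h fund_monomial G b h * star (fund_monomial G c h) = (b == c)%:R.
Proof.
elim: k b c => [|k IH] b c.
  have -> : b == c by apply/eqP/ffunP=> -[].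
  by rewrite (sum_ffun0 _ b) !fund_monomial0 star1 mulr1.
rewrite -(cons_index_eta b) -(cons_index_eta c); move: (b ord0) (c ord0) => b0 c0.
set b' := [ffun _ => _]; set c' := [ffun _ => _].
have e : \sum_a fund G b0 a * fund G c0 a = (b0 == c0)%:R.
  have /matrixP/(_ b0 c0) := fund_orthor G; rewrite !mxE => <-.
  by apply: eq_bigr => a _; rewrite !mxE.
transitivity (\sum_a fund G b0 a * (b' == c')%:R * fund G c0 a).
  rewrite sum_cons_index; apply: eq_bigr => a _.
  rewrite -IH mulr_sumr mulr_suml; apply: eq_bigr => f _.
  by rewrite !fund_monomialS starM fund_star !mulrA.
rewrite cons_index_eq; case: (b' == c') => /=.
  by rewrite andbT -e; apply: eq_bigr => f _; rewrite mulr1.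
by rewrite andbF big1 // => f _; rewrite mulr0 mul0r.
Qed.

Lemma fund_powE (K : numClosedFieldType) N (G : cmqg K N) k a b :
  fund_pow G k a b = fund_monomial G (enum_val a) (enum_val b).
Proof. by rewrite mxE. Qed.

Lemma fund_pow_unitary (K : numClosedFieldType) N (G : cmqg K N) k :
  star_mx (fund_pow G k) *m fund_pow G k = 1%:M /\
  fund_pow G k *m star_mx (fund_pow G k) = 1%:M.
Proof.
split; apply/matrixP=> a b; rewrite !mxE.
  rewrite -(inj_eq enum_val_inj) -(fund_monomial_orthol G) -[RHS]sum_enum_val.
  by apply: eq_bigr => c _; rewrite star_mxE !fund_powE.
rewrite -(inj_eq enum_val_inj) -(fund_monomial_orthor G) -[RHS]sum_enum_val.
by apply: eq_bigr => c _; rewrite star_mxE !fund_powE.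
Qed.

Lemma fund_monomial_comult (K : numClosedFieldType) N (G : cmqg K N) k
    (b c : {ffun 'I_k -> 'I_N}) :
  comult G (fund_monomial G b c) =
  \sum_h coord2l G (fund_monomial G b h) * coord2r G (fund_monomial G h c).
Proof.
have [_ _ comm _] := coord2_tensor G.
rewrite /fund_monomial rmorph_prod (eq_bigr _ (fun s _ => comult_fund G _ _)).
rewrite bigA_distr_bigA; apply: eq_bigr => h _.
rewrite GRing.prodrM_comm ?rmorph_prod // => i j _ _; exact: comm.
Qed.

Lemma fund_pow_rep (K : numClosedFieldType) N (G : cmqg K N) k :
  is_rep (fund_pow G k).
Proof.
split; last by exists (star_mx (fund_pow G k)); exact: fund_pow_unitary.
move=> a b; rewrite fund_powE fund_monomial_comult -sum_enum_val.
by apply: eq_bigr => h _; rewrite !fund_powE.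
Qed.

(** The orthogonal projection onto a subrepresentation [F] of a unitary
    representation [v] commutes with [v]: the subspace is invariant under [v]
    and, [w] being invertible, under the inverse of [v], which is its adjoint. *)
Lemma orthoproj_subrep (K : numClosedFieldType) N (G : cmqg K N) m n
    (v : 'M[coord G]_n) (w : 'M[coord G]_m) (F : 'M[K]_(n, m)) :
  star_mx v *m v = 1%:M -> is_rep w -> Hom w v F ->
  exists X : 'M[K]_(m, n),
    [/\ is_orthoproj (F *m X), F *m X *m F = F & Hom v v (F *m X)].
Proof.
move=> v1 [_ [w' [w'w ww']]] HF; have [X [oP PF]] := orthoproj_range F.
exists X; split=> //; set P := F *m X in oP PF *.
have HF' : star_mx v *m scal_mx G F = scal_mx G F *m w'.
  rewrite -[RHS]mul1mx -v1 -!mulmxA (mulmxA v) -HF -!mulmxA ww' mulmx1.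
  by [].
have inv x y : scal_mx G F *m x = y *m scal_mx G F ->
    y *m scal_mx G P = scal_mx G P *m y *m scal_mx G P.
  move=> e; have ey : y *m scal_mx G P = scal_mx G F *m x *m scal_mx G X.
    by rewrite scal_mxM mulmxA -e.
  by rewrite -[RHS]mulmxA ey !mulmxA -scal_mxM PF.
have e1 := inv _ _ HF; have e2 := inv _ _ (esym HF').
have := congr1 (@star_mx _ _ _ _) e2; rewrite !star_mxM star_mxK star_mx_scal.
have [_] := oP; rewrite -[adjmx _]/(ctr _) => -> e3.
by rewrite /Hom e3 mulmxA -e1.
Qed.

(** * The representations u_p *)

Lemma equiv_rep_refl (K : numClosedFieldType) N (G : cmqg K N) n
    (v : 'M[coord G]_n) : equiv_rep v v.
Proof. by exists 1%:M, 1%:M; split; [apply: Hom1|rewrite mulmx1|rewrite mulmx1]. Qed.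

Lemma equiv_rep_sym (K : numClosedFieldType) N (G : cmqg K N) m n
    (v : 'M[coord G]_m) (w : 'M[coord G]_n) : equiv_rep v w -> equiv_rep w v.
Proof.
case=> T [T' [H e1 e2]]; exists T', T; split=> //; rewrite /Hom.
have -> : w = scal_mx G T *m v *m scal_mx G T'.
  by rewrite H -mulmxA -scal_mxM e2 scal_mx1 mulmx1.
by rewrite !mulmxA -scal_mxM e1 scal_mx1 mul1mx.
Qed.

Lemma equiv_rep_trans (K : numClosedFieldType) N (G : cmqg K N) m n p
    (u : 'M[coord G]_m) (v : 'M[coord G]_n) (w : 'M[coord G]_p) :
  equiv_rep u v -> equiv_rep v w -> equiv_rep u w.
Proof.
case=> T [T' [H e1 e2]] [S [S' [H' e1' e2']]].
exists (S *m T), (T' *m S'); split; first exact: Hom_mul H H'.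
  by rewrite mulmxA -(mulmxA T') e1' mulmx1.
by rewrite mulmxA -(mulmxA S) e2 mulmx1.
Qed.

Lemma u_part_rep (K : numClosedFieldType) N (G : cmqg K N.+1) C k (p : part k k) :
  is_easy G C -> p \in Proj C k ->
  is_rep (u_part G C p) /\ Hom (u_part G C p) (fund_pow G k) (col_base (P_part G C p)).
Proof.
move=> ez pC; have [HP PP _ _ _] := P_part_facts ez pC.
exact: sub_rep_endo (fund_pow_rep G k) PP HP.
Qed.

(** A subrepresentation of [u_p] gives an orthogonal projection in the
    endomorphisms of the tensor power lying below [P_p]; these being scalar on
    the range of [P_p], the projection is 0 or [P_p]. *)
Lemma u_part_irreducible (K : numClosedFieldType) N (G : cmqg K N.+4) C k
    (p : part k k) : is_noncrossing_category C -> is_easy G C ->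
  p \in Proj C k -> u_dim G C p <> 0%N /\ irreducible_rep (u_part G C p).
Proof.
move=> nc ez pC; have [repu HB] := u_part_rep ez pC.
have [HP PP Ph _ _] := P_part_facts ez pC.
have nz := P_part_neq0 nc ez pC.
have dim0 : u_dim G C p <> 0%N.
  by move/eqP; rewrite mxrank_eq0 (negPf nz).
split=> //; split=> //; first by rewrite lt0n; apply/eqP.
move=> m w E repw HE rE.
set P := P_part G C p in HP PP Ph nz HB HE *.
pose F := col_base P *m E.
have PF : P *m F = F by rewrite mulmxA (idem_col_base PP).
have rF : \rank F = m.
  have eE : E = row_base P *m F by rewrite mulmxA (row_base_col_base PP) mul1mx.
  rewrite -[RHS]rE; apply/eqP; rewrite eqn_leq; apply/andP; split.
    exact: mxrankM_maxr.
  by rewrite {1}eE; exact: mxrankM_maxr.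
have [X [[QQ Qh] QF HQ]] := orthoproj_subrep (fund_pow_unitary G k).1 repw (Hom_mul HE HB).
rewrite -/F in QQ Qh QF HQ; rewrite -[adjmx _]/(ctr _) in Qh.
set Q := F *m X in QQ Qh QF HQ.
have PQ : P *m Q = Q by rewrite mulmxA PF.
have QP : Q *m P = Q by rewrite -Qh -{1}Ph -ctr_mul PQ.
have rQ : \rank Q = m.
  rewrite -rF; apply/eqP; rewrite eqn_leq mxrankM_maxl -{1}QF.
  exact: mxrankM_maxl.
have [c] := P_part_endo nc ez pC HQ; rewrite -/P PQ QP => eQ.
have : (c * (c - 1)) *: P = 0.
  rewrite mulrBr mulr1 scalerBl -scalerA -eQ; apply/eqP; rewrite subr_eq0.
  by rewrite -{2}QQ {2}eQ -scalemxAl PQ.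
move/eqP; rewrite scaler_eq0 (negPf nz) orbF mulf_eq0 subr_eq0.
case/orP=> /eqP ec; [left | right].
  by rewrite -rQ eQ ec scale0r mxrank0.
by rewrite -rQ eQ ec scale1r.
Qed.

Lemma mulmx_sandwich (R : pzRingType) a b c d e f g (A : 'M[R]_(a, b))
    (X : 'M_(b, c)) (B : 'M_(c, d)) (A' : 'M_(d, e)) (Y : 'M_(e, f))
    (B' : 'M_(f, g)) :
  A *m X *m B *m (A' *m Y *m B') = A *m (X *m (B *m A' *m Y)) *m B'.
Proof. by rewrite !mulmxA. Qed.

(** Compressed to the ranges of [P_p] and [P_q], the map of [r] and its adjoint
    are inverse to each other up to a scalar. *)
Lemma u_part_equiv (K : numClosedFieldType) N (G : cmqg K N.+4) C k l
    (p : part k k) (q : part l l) :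
  is_noncrossing_category C -> is_easy G C -> p \in Proj C k -> q \in Proj C l ->
  equiv_part C p q <-> equiv_rep (u_part G C p) (u_part G C q).
Proof.
move=> nc ez pC qC; have [catC _] := nc.
have [HP PP _ pP _] := P_part_facts ez pC.
have [HQ QQ _ qQ _] := P_part_facts ez qC.
have [_ HBp] := u_part_rep ez pC; have [_ HBq] := u_part_rep ez qC.
have HAp := Hom_row_base PP HP; have HAq := Hom_row_base QQ HQ.
have nzP : P_part G C p != 0 := P_part_neq0 nc ez pC.
set P := P_part G C p in HP PP pP HBp HAp nzP *.
set Q := P_part G C q in HQ QQ qQ HBq HAq *.
split=> [[r [rC e1 e2]]|[T [T' [HT T'T TT']]]]; last first.
  have HX := Hom_mul (Hom_mul HAp HT) HBq.
  apply: (P_part_hom catC ez pC qC HX); rewrite -/P -/Q.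
  rewrite (mulmxA Q (col_base Q)) (idem_col_base QQ) -(mulmxA (col_base Q)).
  rewrite -(mulmxA T) (row_base_idem PP).
  apply: contraNneq nzP => e0; have : T = 0.
    have := congr1 (fun Y => row_base Q *m Y *m col_base P) e0.
    rewrite mulmx0 mul0mx (mulmxA (row_base Q)) (row_base_col_base QQ) mul1mx.
    by rewrite -(mulmxA T) (row_base_col_base PP) mulmx1.
  move=> T0; rewrite -(mulmx_base P) -[col_base P]mulmx1 -T'T T0 mulmx0.
  by rewrite mulmx0 mul0mx.
have eqr : Q *m Tring K N.+4 r = Tring K N.+4 r *m P.
  exact: P_part_Tring catC ez pC qC rC e1 e2.
have [c c0 ec] := ctr_Tring_mul K N.+3 e1.
have [d d0 ed] : exists2 d : K, d != 0 &
    Tring K N.+4 r *m Tring K N.+4 (star_part r) = d *: Tpart K N.+4 q.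
  have [|d d0 ed] := @ctr_Tring_mul K N.+3 _ _ q (star_part r).
    by rewrite star_partK.
  by exists d => //; rewrite -ed star_partK.
have eqr' : P *m Tring K N.+4 (star_part r) = Tring K N.+4 (star_part r) *m Q.
  apply: (P_part_Tring catC ez qC pC (cat_star catC rC)); last by rewrite star_partK.
  by rewrite star_partK.
pose S := row_base Q *m Tring K N.+4 r *m col_base P.
pose S' := row_base P *m Tring K N.+4 (star_part r) *m col_base Q.
have S'S : S' *m S = c *: 1%:M.
  rewrite mulmx_sandwich mulmx_base eqr (mulmxA (Tring K N.+4 _)) ec.
  rewrite -scalemxAl pP -scalemxAr -scalemxAl (row_base_idem PP).
  by rewrite (row_base_col_base PP).
have SS' : S *m S' = d *: 1%:M.
  rewrite mulmx_sandwich mulmx_base eqr' (mulmxA (Tring K N.+4 _)) ed.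
  rewrite -scalemxAl qQ -scalemxAr -scalemxAl (row_base_idem QQ).
  by rewrite (row_base_col_base QQ).
(* Associativity of [S' S S'] makes the two constants agree. *)
have S'E : c^-1 *: S' = d^-1 *: S'.
  have : S' *m S *m S' = S' *m (S *m S') by rewrite mulmxA.
  rewrite S'S SS' -scalemxAl mul1mx -scalemxAr mulmx1 => e.
  apply: (scalerI c0); rewrite scalerA divff // scale1r scalerA mulrC -scalerA e.
  by rewrite scalerA mulVf ?scale1r.
exists S, (c^-1 *: S'); split.
- apply: Hom_mul HBp _; apply: Hom_mul HAq; exact: Tring_Hom ez rC.
- by rewrite -scalemxAl S'S scalerA mulVf ?scale1r.
by rewrite S'E -scalemxAr SS' scalerA mulVf ?scale1r.
Qed.

Lemma exists_minimal (T : finType) (r : rel T) (P : pred T) x0 :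
  transitive r -> antisymmetric r -> P x0 ->
  exists2 x, P x & forall y, P y -> r y x -> y = x.
Proof.
move=> rT rA Px0; pose D x := [set y | r y x && (y != x)]%SET.
case: (arg_minnP (fun x => #|D x|) Px0) => x Px minx; exists x => // y Py ryx.
apply/eqP; apply: contraT => nyx; have := minx y Py; rewrite leqNgt => /negP[].
apply: proper_card; apply/properP; split; last first.
  by exists y; rewrite !inE ?eqxx ?andbF // ryx nyx.
apply/subsetP=> z; rewrite !inE => /andP[rzy nzy].
rewrite (rT _ _ _ rzy ryx); apply: contraNneq nzy => ezx.
by apply/eqP/rA; rewrite rzy ezx ryx.
Qed.

(** An intertwiner [T] into a tensor power is seen by some [T_p], and by
    [P_p] when [p] is minimal with this property. *)
Lemma irreducible_is_u_part (K : numClosedFieldType) N (G : cmqg K N.+4) C k n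
    (v : 'M[coord G]_n) (T : 'M[K]_(_, n)) :
  is_noncrossing_category C -> is_easy G C -> irreducible_rep v ->
  Hom v (fund_pow G k) T -> T != 0 ->
  exists2 p : part k k, p \in Proj C k & equiv_rep v (u_part G C p).
Proof.
move=> nc ez irr HT nzT; have [catC _] := nc.
have [p0 p0P] : exists p, (p \in Proj C k) && (Tpart K N.+4 p *m T != 0).
  have [Y YT e1] := Hom_fund_pow_span ez (Hom1 (fund_pow G k)).
  have [r rC nz] : exists2 r, r \in C k k & Tring K N.+4 r *m T != 0.
    apply: contra_neqP nzT => nex; rewrite -[T]mul1mx e1 mulmx_suml big1 // => r rC.
    have [c ->] := YT r rC; rewrite -scalemxAl.
    have [->|nz] := eqVneq (Tring K N.+4 r *m T) 0; first by rewrite scaler0.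
    by case: nex; exists r.
  have pC := Proj_comp_star catC rC; exists (comp_part r (star_part r)).
  rewrite pC /=; apply: contraNneq nz => e.
  by rewrite -(Tring_Tpart K N.+3 (Proj_projective pC) (comp_part_star_self r))
    -mulmxA e mulmx0.
pose below (q p : part k k) :=
  [&& q \in Proj C k, p \in Proj C k & dominated q p].
have below_trans : transitive below.
  move=> q p r /and3P[pC qC dpq] /and3P[_ rC dqr].
  by apply/and3P; exact: And3 pC rC (dominated_trans dqr dpq).
have below_anti : antisymmetric below.
  move=> p q /andP[/and3P[pC qC dpq] /and3P[_ _ dqp]].
  exact: dominated_anti (Proj_projective pC) (Proj_projective qC) dqp dpq.
have [p /andP[pC nzp] minp] := exists_minimal below_trans below_anti
  (P := fun p => (p \in Proj C k) && (Tpart K N.+4 p *m T != 0)) p0P.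
exists p => //; have [HP PP _ _ _] := P_part_facts ez pC.
have kill q : q \in Proj C k -> sdominated q p -> Tpart K N.+4 q *m T = 0.
  move=> qC /andP[dqp neq]; apply/eqP; apply: contraTT neq => nzq.
  rewrite negbK; apply/eqP/minp; first by rewrite qC nzq.
  by apply/and3P; exact: And3 qC pC dqp.
have PT : P_part G C p *m T != 0.
  have [[_ [_ Rh] _ _] [X eR]] := R_part_correct p ez.
  suff R0 : R_part G C p *m T = 0 by rewrite mulmxBl R0 subr0.
  rewrite -Rh -[adjmx _]/(ctr _) eR ctr_mul -mulmxA.
  rewrite /ctr raddf_sum map_mx_sum mulmx_suml big1 ?mulmx0 // => q /andP[qC sq].
  have [_ qh] := Tpart_orthoproj K N.+3 (Proj_projective qC).
  by rewrite /adjmx in qh; rewrite qh kill.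
have HS := Hom_mul HT (Hom_row_base PP HP).
have S0 : row_base (P_part G C p) *m T != 0.
  by apply: contraNneq PT => S0; rewrite -(mulmx_base (P_part G C p)) -mulmxA S0 mulmx0.
have [dim0 irru] := u_part_irreducible nc ez pC.
have repu : is_rep (u_part G C p) by case: irru.
have rS := irreducible_inj irr repu HS S0.
set S := row_base _ *m T in HS S0 rS.
have [rv n0 _] := irr; have [_ _ minu] := irru.
case: (minu _ _ _ rv HS rS) => en; first by rewrite en in n0.
have fS : row_free S by rewrite /row_free rS en.
have fS' : row_full S by rewrite /row_full rS.
exists S, (pinvmx S); split=> //; first exact: mulVpmx.
exact: mulmxVp.
Qed.

(** * Every irreducible representation maps to a tensor power *)

Definition functional (K : numClosedFieldType) (V : lmodType K) (f : V -> K) :=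
  forall c a b, f (c *: a + b) = c * f a + f b.

(** By Zorn's lemma there is a maximal subspace avoiding [y]; every vector is
    congruent to a unique multiple of [y] modulo it. *)
Lemma functional_separates (K : numClosedFieldType) (V : lmodType K) (y : V) :
  (forall f : V -> K, functional f -> f y = 0) -> y = 0.
Proof.
move=> y0; apply/eqP; apply: contraT => nzy.
pose closed (A : set V) := forall c a b, A a -> A b -> A (c *: a + b).
pose P : set (set V) := fun A => closed A /\ ~ A y.
have [A [[Alin Ay] Amax]] : exists A, P A /\ forall B, (A `<` B)%classic -> ~ P B.
  apply: Zorn_bigcup => F FP tot; split; last by case=> A FA; case: (FP A FA).
  move=> c a b [A FA Aa] [B FB Bb].
  case: (tot A B FA FB) => sub.
    by exists B => //; apply: (FP B FB).1 => //; apply: sub.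
  by exists A => //; apply: (FP A FA).1 => //; apply: sub.
have A0 : A 0.
  have [[a Aa]|nA] := pselect (exists a, A a).
    by rewrite -(addNr a) -scaleN1r; apply: Alin.
  case: (Amax [set 0]%classic).
    split=> [a Aa|sub]; first by case: nA; exists a.
    by case: nA; exists 0; apply: sub.
  split=> [c a b -> ->|/= e]; first by rewrite /= scaler0 addr0.
  by rewrite e eqxx in nzy.
have AZ c a : A a -> A (c *: a) by move=> Aa; rewrite -[_ *: _]addr0; apply: Alin.
have AB a b : A a -> A b -> A (a - b).
  by move=> Aa Ab; rewrite addrC -scaleN1r; apply: Alin.
have dec x : exists c, A (x - c *: y).
  apply: contrapT => nc.
  pose B : set V := fun u => exists2 a, A a & exists d, u = a + d *: x.
  have nx c : ~ A (x - c *: y) by move=> Ac; apply: nc; exists c.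
  case: (Amax B).
    split=> [a Aa|sub]; first by exists a => //; exists 0; rewrite scale0r addr0.
    apply: (nx 0); rewrite scale0r subr0; apply: sub.
    by exists 0 => //; exists 1; rewrite scale1r add0r.
  split=> [c _ _ [a Aa [d ->]] [b Ab [e ->]]|[a Aa [d ey]]].
    exists (c *: a + b); first exact: Alin.
    by exists (c * d + e); rewrite scalerDr scalerDl scalerA addrACA.
  have [d0|d0] := eqVneq d 0; first by apply: Ay; rewrite ey d0 scale0r addr0.
  apply: (nx d^-1); rewrite ey scalerDr scalerA mulVf // scale1r opprD addrCA subrr addr0.
  by rewrite -scaleNr; apply: AZ.
pose f x := projT1 (cid (dec x)).
have fA x : A (x - f x *: y) by apply: projT2 (cid (dec x)).
have funi x c : A (x - c *: y) -> f x = c.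
  move=> Ac; apply/eqP; apply: contraT => ne; case: Ay.
  rewrite -[y]scale1r -(mulVf (_ : f x - c != 0)) ?subr_eq0 // -scalerA.
  apply: AZ; have := AB _ _ Ac (fA x).
  by rewrite opprB addrC addrA subrK -scalerBl.
have flin : functional f.
  move=> c a b; apply: funi; rewrite scalerDl opprD addrACA -scalerA -scalerBr.
  exact: Alin.
have := y0 f flin; rewrite (funi y 1) ?scale1r ?subrr // => /eqP.
by rewrite oner_eq0.
Qed.

Lemma functional_sum (K : numClosedFieldType) (V : lmodType K) (f : V -> K)
    (I : finType) (c : I -> K) (x : I -> V) :
  functional f -> f (\sum_i c i *: x i) = \sum_i c i * f (x i).
Proof.
move=> lf; have f0 : f 0 = 0.
  have := lf 1 0 0; rewrite scaler0 addr0 mul1r => /esym/eqP.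
  by rewrite -subr_eq0 addrK => /eqP.
elim/big_rec2: _ => [|i s t _ <-]; first exact: f0.
exact: lf.
Qed.

(** This is the slice map id (x) f, given by the universal property of the tensor
    square. *)
Lemma slice_map (K : numClosedFieldType) N (G : cmqg K N) (f : coord G -> K) :
  functional f -> exists F : coord2 G -> coord G,
    (forall (I : finType) (x : I -> coord2 G), F (\sum_i x i) = \sum_i F (x i)) /\
    (forall c x, F (c *: x) = c *: F x) /\
    forall a b, F (coord2l G a * coord2r G b) = f b *: a.
Proof.
move=> lf; have [_ _ _ univ] := coord2_tensor G.
have [|F [[Flin FE] _]] := univ (coord G) (fun a b => f b *: a).
  move=> c a a' b; split; first by rewrite scalerDr !scalerA mulrC.
  by rewrite lf scalerDl scalerA.
have F0 : F 0 = 0.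
  have := Flin 1 0 0; rewrite scaler0 addr0 scale1r => /esym/eqP.
  by rewrite -subr_eq0 addrK => /eqP.
exists F; split=> [I x|].
  apply: big_morph => [a b|//].
  by have := Flin 1 a b; rewrite !scale1r.
split=> [c x|a b]; last exact: FE.
by have := Flin c x 0; rewrite !addr0 F0 addr0.
Qed.

(** This describes the finite direct sums of tensor powers without naming their
    summands: a nonzero intertwiner into the sum has a nonzero component in some
    tensor power. *)
Definition tensor_sum (K : numClosedFieldType) N (G : cmqg K N) m
    (w : 'M[coord G]_m) : Prop :=
  [/\ comultiplicative w, forall i j, antipode G (w i j) = star (w j i)
    & forall n (v : 'M[coord G]_n) T, Hom v w T -> T != 0 ->
        exists k (S : 'M_(_, n)), Hom v (fund_pow G k) S /\ S != 0].

Definition coef_span (K : numClosedFieldType) N (G : cmqg K N) m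
    (w : 'M[coord G]_m) (x : coord G) : Prop :=
  exists c : 'M[K]_m, x = \sum_i \sum_j c i j *: w i j.

Lemma fund_monomial_antipode (K : numClosedFieldType) N (G : cmqg K N) k
    (b c : {ffun 'I_k -> 'I_N}) :
  antipode G (fund_monomial G b c) = star (fund_monomial G c b).
Proof.
elim: k b c => [|k IH] b c; first by rewrite !fund_monomial0 antipode1 star1.
rewrite -(cons_index_eta b) -(cons_index_eta c) !fund_monomialS antipodeM starM.
by rewrite IH antipode_fund fund_star.
Qed.

Lemma tensor_sum_fund_pow (K : numClosedFieldType) N (G : cmqg K N) k :
  tensor_sum (fund_pow G k).
Proof.
split=> [|i j|n v T HT nz]; last by exists k, T.
  by apply/comultiplicativeP; have [] := fund_pow_rep G k.
by rewrite !fund_powE fund_monomial_antipode.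
Qed.

Lemma tensor_sum_block (K : numClosedFieldType) N (G : cmqg K N) m1 m2
    (w1 : 'M[coord G]_m1) (w2 : 'M[coord G]_m2) :
  tensor_sum w1 -> tensor_sum w2 -> tensor_sum (block_mx w1 0 0 w2).
Proof.
case=> c1 a1 h1 [c2 a2 h2]; split.
- rewrite /comultiplicative !map_block_mx mulmx_block c1 c2 !map_mx0.
  by rewrite !mulmx0 !mul0mx !addr0 !add0r.
- move=> i j; rewrite -[block_mx _ _ _ _ j i]/(block_mx w1 0 0 w2 j i).
  have star0 : star (0 : coord G) = 0.
    by have := starZ 0 (0 : coord G); rewrite !scale0r conjC0 scale0r.
  case: (split_ordP i) => i' ->; case: (split_ordP j) => j' ->.
  + by rewrite !block_mxEul.
  + by rewrite block_mxEur block_mxEdl !mxE linear0 star0.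
  + by rewrite block_mxEdl block_mxEur !mxE linear0 star0.
  by rewrite !block_mxEdr.
move=> n v T; rewrite -[T]vsubmxK /Hom /scal_mx map_col_mx mul_col_mx mul_block_col.
rewrite !mul0mx addr0 add0r => /eq_col_mx[e1 e2] nz.
have [z1|nz1] := eqVneq (usubmx T) 0; last exact: h1 e1 nz1.
have [z2|nz2] := eqVneq (dsubmx T) 0; last exact: h2 e2 nz2.
by rewrite z1 z2 col_mx0 eqxx in nz.
Qed.

Lemma coef_span_block (K : numClosedFieldType) N (G : cmqg K N) m1 m2
    (w1 : 'M[coord G]_m1) (w2 : 'M[coord G]_m2) x1 x2 :
  coef_span w1 x1 -> coef_span w2 x2 ->
  coef_span (block_mx w1 0 0 w2) (x1 + x2).
Proof.
case=> c1 -> [c2 ->]; exists (block_mx c1 0 0 c2); rewrite big_split_ord /=.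
congr (_ + _); apply: eq_bigr => i _; rewrite big_split_ord /=.
  rewrite [X in _ + X]big1 => [|j _]; last by rewrite !block_mxEur !mxE scale0r.
  by rewrite addr0; apply: eq_bigr => j _; rewrite !block_mxEul.
rewrite [X in X + _]big1 => [|j _]; last by rewrite !block_mxEdl !mxE scale0r.
by rewrite add0r; apply: eq_bigr => j _; rewrite !block_mxEdr.
Qed.

Lemma coef_span0 (K : numClosedFieldType) N (G : cmqg K N) m
    (w : 'M[coord G]_m) : coef_span w 0.
Proof.
exists 0; rewrite big1 // => i _; rewrite big1 // => j _.
by rewrite mxE scale0r.
Qed.

Lemma coef_span_entry (K : numClosedFieldType) N (G : cmqg K N) m
    (w : 'M[coord G]_m) c i j : coef_span w (c *: w i j).
Proof.
exists (c *: delta_mx i j); rewrite (bigD1 i) //= (bigD1 j) //= !mxE !eqxx mulr1.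
rewrite !big1 ?addr0 // => [i' ni|j' nj].
  by rewrite big1 // => j' _; rewrite !mxE (negPf ni) mulr0 scale0r.
by rewrite !mxE (negPf nj) andbF mulr0 scale0r.
Qed.

Inductive fund_combination (K : numClosedFieldType) N (G : cmqg K N) :
    coord G -> Prop :=
| FundCombination0 : fund_combination 0
| FundCombinationS k (b c : {ffun 'I_k -> 'I_N}) (a : K) x :
    fund_combination x -> fund_combination (a *: fund_monomial G b c + x).

(** Left multiplication by a generator preserves the combinations of monomials;
    the elements with this property form a subalgebra, which is everything. *)
Lemma fund_combinationP (K : numClosedFieldType) N (G : cmqg K N) (x : coord G) :
  fund_combination x.
Proof.
have comb_lin (c : K) (y z : coord G) : fund_combination y -> fund_combination z ->
    fund_combination (c *: y + z).
  move=> hy hz; elim: hy => [|k b d a y' _ IH]; first by rewrite scaler0 add0r.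
  by rewrite scalerDr scalerA -addrA; apply: FundCombinationS.
pose S (a : coord G) := forall y, fund_combination y -> fund_combination (a * y).
have : S x.
  apply: (fund_gen (S := S)) => [y|c a b Sa Sb y hy|a b Sa Sb y hy|i j y].
  - by rewrite mul1r.
  - by rewrite mulrDl -scalerAl; apply: comb_lin; [apply: Sa|apply: Sb].
  - by rewrite -mulrA; apply/Sa/Sb.
  elim=> [|k b c a y' _ IH]; first by rewrite mulr0; apply: FundCombination0.
  rewrite mulrDr -scalerAr -fund_monomialS; exact: FundCombinationS.
move/(_ 1); rewrite mulr1; apply.
pose e : {ffun 'I_0 -> 'I_N} := ffun0 (card_ord 0).
have := FundCombinationS e e 1 (FundCombination0 G).
by rewrite fund_monomial0 scale1r addr0.
Qed.

Lemma exists_tensor_sum (K : numClosedFieldType) N (G : cmqg K N)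
    (s : seq (coord G)) :
  exists m (w : 'M[coord G]_m), tensor_sum w /\
    forall x, x \in s -> coef_span w x.
Proof.
have one x : exists m (w : 'M[coord G]_m), tensor_sum w /\ coef_span w x.
  elim: (fund_combinationP x) => [|k b c a y _ [m [w [tw cw]]]].
    exists #|{: {ffun 'I_0 -> 'I_N}}|, (fund_pow G 0).
    by split; [apply: tensor_sum_fund_pow|apply: coef_span0].
  exists (#|{: {ffun 'I_k -> 'I_N}}| + m)%N, (block_mx (fund_pow G k) 0 0 w).
  split; first exact: tensor_sum_block (tensor_sum_fund_pow G k) tw.
  apply: coef_span_block cw; rewrite -(enum_rankK b) -(enum_rankK c) -fund_powE.
  exact: coef_span_entry.
elim: s => [|x s [m [w [tw cw]]]].
  by have [m [w [tw _]]] := one 0; exists m, w.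
have [m' [w' [tw' cw']]] := one x; exists (m' + m)%N, (block_mx w' 0 0 w).
split; first exact: tensor_sum_block.
move=> y; rewrite inE => /orP[/eqP->|ys].
  by rewrite -[x]addr0; apply: coef_span_block (coef_span0 w).
by rewrite -[y]add0r; apply: coef_span_block (coef_span0 w') (cw _ ys).
Qed.

(** The kernel is the row space of a matrix of maximal rank among those whose rows
    lie in it. *)
Lemma orthoproj_kernel (K : numClosedFieldType) (V : lmodType K) d
    (phi : 'rV[K]_d -> V) :
  (forall x y, phi (x + y) = phi x + phi y) ->
  (forall c x, phi (c *: x) = c *: phi x) ->
  exists2 Q : 'M[K]_d, is_orthoproj Q & forall x, phi x = 0 <-> x *m Q = x.
Proof.
move=> phiD phiZ.
pose inker (B : 'M[K]_d) := forall x : 'rV_d, phi (x *m B) = 0.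
pose P r := `[< exists B, inker B /\ \rank B = r >].
have phi0 : phi 0 = 0 by rewrite -(scale0r 0) phiZ scale0r.
have P0 : exists r, P r.
  exists 0%N; apply/asboolP; exists 0; split; last exact: mxrank0.
  by move=> x; rewrite mulmx0.
have Pd r : P r -> (r <= d)%N by move/asboolP=> [B [_ <-]]; apply: rank_leq_row.
case: (ex_maxnP P0 Pd) => r /asboolP[B [kB rB]] maxB.
have kerB x : phi x = 0 <-> (x <= B)%MS.
  split=> [x0|/submxP[y ->]]; last exact: kB.
  have kB' : inker (B + x)%MS.
    move=> y; have : (y *m (B + x)%MS <= B + x)%MS := submxMl _ _.
    case/sub_addsmxP=> -[u1 u2] /= ->; rewrite phiD kB add0r.
    by rewrite (mx11_scalar u2) mul_scalar_mx phiZ x0 scaler0.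
  have : (\rank (B + x)%MS <= \rank B)%N.
    by rewrite rB; apply: maxB; apply/asboolP; exists (B + x)%MS.
  rewrite (geq_leqif (mxrank_leqif_sup (addsmxSl B x))) addsmx_sub.
  by case/andP.
have [X [[QQ Qh] QB]] := orthoproj_range (ctr B).
rewrite -[adjmx _]/(ctr _) in Qh; set Q := ctr B *m X in QQ Qh QB *.
exists Q => // x; rewrite kerB; split=> [/submxP[y ->]|<-].
  have := congr1 (@ctr K d d) QB; rewrite ctr_mul Qh ctrK => BQ.
  by rewrite -mulmxA BQ.
by rewrite -Qh ctr_mul ctrK mulmxA submxMl.
Qed.

Lemma mulmx_row_ext (K : fieldType) m n (A B : 'M[K]_(m, n)) :
  (forall x : 'rV_m, x *m A = x *m B) -> A = B.
Proof. by move=> e; apply/row_matrixP=> i; rewrite !rowE. Qed.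

(** A row of [v] is a combination of coefficients of some [w] in [tensor_sum]. The
    combinations representing 0 form the range of an orthogonal projection [Q]
    commuting with all the operators [rho f], so the row has a canonical lift [e]
    killed by [Q]. Comparing the two ways to slice the comultiplication shows that
    [e] transforms like [v], and functionals separate the entries of this
    equation. *)
Lemma rep_Hom_fund_pow (K : numClosedFieldType) N (G : cmqg K N) n
    (v : 'M[coord G]_n) :
  is_rep v -> (0 < n)%N ->
  exists k (T : 'M[K]_(_, n)), Hom v (fund_pow G k) T /\ T != 0.
Proof.
case=> cv [v' [v'v vv']] n0; pose i0 : 'I_n := Ordinal n0.
have [m [w [[/comultiplicativeP cw aw hw] spanw]]] :=
  exists_tensor_sum [seq v i0 j | j : 'I_n].
pose D := #|{: 'I_m * 'I_m}|.
pose z (t : 'I_D) := w (enum_val t).1 (enum_val t).2.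
pose phi (x : 'rV[K]_D) := \sum_t x 0 t *: z t.
have phiD x y : phi (x + y) = phi x + phi y.
  by rewrite -big_split; apply: eq_bigr => t _; rewrite mxE scalerDl.
have phiZ c x : phi (c *: x) = c *: phi x.
  by rewrite scaler_sumr; apply: eq_bigr => t _; rewrite mxE scalerA.
have phi_sum (I : finType) (x : I -> 'rV_D) : phi (\sum_i x i) = \sum_i phi (x i).
  apply: big_morph => //.
  by rewrite /phi big1 // => t _; rewrite mxE scale0r.
have [x xE] : exists x : 'I_n -> 'rV[K]_D, forall j, phi (x j) = v i0 j.
  apply: (@fin_all_exists _ (fun=> _) (fun j y => phi y = v i0 j)) => j.
  have [|c ec] := spanw (v i0 j).
    by apply/imageP; exists j.
  exists (\row_t c (enum_val t).1 (enum_val t).2).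
  rewrite ec pair_big /= -(sum_enum_val (fun p : 'I_m * 'I_m => c p.1 p.2 *: w p.1 p.2)).
  by apply: eq_bigr => t _; rewrite mxE.
have [Q [QQ Qh] kerQ] := orthoproj_kernel phiD phiZ.
rewrite -[adjmx _]/(ctr _) in Qh.
(* The functional [f] acts on coefficients by [id (x) f] after the
   comultiplication. *)
pose rho (f : coord G -> K) : 'M[K]_D := \matrix_(s, t)
  (((enum_val s).1 == (enum_val t).1)%:R * f (w (enum_val t).2 (enum_val s).2)).
have phi_rho f F : (forall (I : finType) (x : I -> coord2 G), F (\sum_i x i) = \sum_i F (x i)) ->
    (forall c x, F (c *: x) = c *: F x) ->
    (forall a b, F (coord2l G a * coord2r G b) = f b *: a) ->
    forall y, phi (y *m rho f) = F (comult G (phi y)).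
  move=> FD FZ FE y; rewrite /phi linear_sum FD.
  transitivity (\sum_t \sum_s (y 0 s * rho f s t) *: z t).
    by apply: eq_bigr => t _; rewrite mxE scaler_suml.
  rewrite exchange_big; apply: eq_bigr => s _; rewrite linearZ FZ /z /= cw FD scaler_sumr.
  pose H (p : 'I_m * 'I_m) : coord G :=
    (y 0 s * (((enum_val s).1 == p.1)%:R * f (w p.2 (enum_val s).2))) *: w p.1 p.2.
  rewrite (eq_bigr (fun t => H (enum_val t))) => [|t _]; last by rewrite mxE.
  rewrite sum_enum_val -(pair_bigA _ (fun a b => H (a, b))) /=.
  rewrite (bigD1 (enum_val s).1) //= [X in _ + X]big1 ?addr0 => [|a na].
    by apply: eq_bigr => b _; rewrite /H /= eqxx mul1r FE scalerA.
  apply: big1 => b _; rewrite /H /= eq_sym (negPf na) mul0r mulr0.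
  by rewrite scale0r.
have stable f : functional f -> Q *m rho f = Q *m rho f *m Q.
  move=> lf; have [F [FD [FZ FE]]] := slice_map lf.
  apply: mulmx_row_ext => y; rewrite !mulmxA; apply/esym/kerQ.
  rewrite (phi_rho f F) //; have -> : phi (y *m Q) = 0.
    by apply/kerQ; rewrite -mulmxA QQ.
  have := FZ 0 0; rewrite !scale0r => F0.
  by rewrite linear0 F0.
(* The antipode provides the adjoint of [rho f], so that the complement of the
   range of [Q] is stable as well. *)
have commQ f : functional f -> Q *m rho f = rho f *m Q.
  move=> lf; pose g (a : coord G) := (f (star (antipode G a)))^*.
  have lg : functional g.
    move=> c a b; rewrite /g linearP starD starZ lf rmorphD rmorphM.
    by rewrite /= conjCK.
  have adj : ctr (rho g) = rho f.
    apply/matrixP=> s t; rewrite !mxE rmorphM rmorph_nat eq_sym /g.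
    by rewrite /= aw starK conjCK.
  have := congr1 (@ctr K D D) (stable g lg).
  by rewrite !ctr_mul adj Qh mulmxA -(stable f lf) => ->.
pose e j := x j *m (1%:M - Q).
have eQ j : e j *m Q = 0 by rewrite -mulmxA mulmxBl mul1mx QQ subrr mulmx0.
have phi_e j : phi (e j) = v i0 j.
  have phiB a b : phi (a - b) = phi a - phi b by rewrite phiD -scaleN1r phiZ scaleN1r.
  rewrite /e mulmxBr mulmx1 phiB xE.
  have /kerQ-> : x j *m Q *m Q = x j *m Q by rewrite -mulmxA QQ.
  by rewrite subr0.
have e_rho f j : functional f -> e j *m rho f = \sum_h f (v h j) *: e h.
  move=> lf; apply/eqP; rewrite -subr_eq0; apply/eqP.
  set y := _ - _; suff [yQ0 yQ] : y *m Q = 0 /\ y *m Q = y by rewrite -yQ.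
  split.
    rewrite mulmxBl -mulmxA -commQ // mulmxA eQ mul0mx sub0r mulmx_suml.
    by rewrite big1 ?oppr0 // => h _; rewrite -scalemxAl eQ scaler0.
  have [F [FD [FZ FE]]] := slice_map lf.
  apply/kerQ; rewrite /y phiD -scaleN1r phiZ scaleN1r (phi_rho f F) // phi_sum.
  rewrite phi_e cv FD; apply/eqP; rewrite subr_eq0; apply/eqP.
  by apply: eq_bigr => h _; rewrite FE phiZ phi_e.
pose E a : 'M[K]_(m, n) := \matrix_(b, j) e j 0 (enum_rank (a, b)).
have HE a : Hom v w (E a).
  apply/esym/matrixP=> h j; apply/eqP; rewrite -subr_eq0; apply/eqP.
  apply: functional_separates => f lf.
  have -> : (w *m scal_mx G (E a)) h j = \sum_b e j 0 (enum_rank (a, b)) *: w h b.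
    rewrite mxE; apply: eq_bigr => b _.
    by rewrite !mxE -scalerAr mulr1.
  have -> : (scal_mx G (E a) *m v) h j = \sum_l e l 0 (enum_rank (a, h)) *: v l j.
    rewrite mxE; apply: eq_bigr => b _.
    by rewrite !mxE -scalerAl mul1r.
  have fB u u' : f (u - u') = f u - f u'.
    by rewrite addrC -scaleN1r lf mulN1r addrC.
  rewrite fB !functional_sum //; apply/eqP; rewrite subr_eq0; apply/eqP.
  have /matrixP/(_ 0 (enum_rank (a, h))) := e_rho f j lf.
  rewrite summxE => er; transitivity ((e j *m rho f) 0 (enum_rank (a, h))).
    rewrite [RHS]mxE; pose H (p : 'I_m * 'I_m) :=
      e j 0 (enum_rank (p.1, p.2)) * ((p.1 == a)%:R * f (w h p.2)).
    rewrite [RHS](eq_bigr (fun t => H (enum_val t))) => [|t _]; last first.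
      by rewrite /H -surjective_pairing enum_valK [rho f _ _]mxE enum_rankK.
    rewrite [RHS]sum_enum_val -(pair_bigA _ (fun a b => H (a, b))) /=.
    rewrite [RHS](bigD1 a) //= [X in _ = _ + X]big1 ?addr0 => [|a' na].
      by apply: eq_bigr => b _; rewrite /H /= eqxx mul1r.
    by apply: big1 => b _; rewrite /H /= (negPf na) mul0r mulr0.
  by rewrite er; apply: eq_bigr => l _; rewrite [LHS]mxE mulrC.
have [a nza] : exists a, E a != 0.
  apply: contrapT => nex; have e0 j : e j = 0.
    apply/matrixP=> i t; rewrite ord1 -(enum_valK t).
    case: (enum_val t) => a b; have := contrapT (fun nz => nex (ex_intro _ a (introN eqP nz))).
    by move=> /matrixP/(_ b j); rewrite !mxE.
  have /matrixP/(_ i0 i0) := vv'; rewrite !mxE eqxx big1 => [/esym/eqP|j _].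
    by rewrite oner_eq0.
  by rewrite -phi_e e0 -(scale0r 0) phiZ scale0r mul0r.
exact: hw (HE a) nza.
Qed.

(** * Equivalence classes *)

Lemma equiv_part_refl C k (p : part k k) : p \in Proj C k -> equiv_part C p p.
Proof.
move=> pC; have pp := Proj_projective pC.
have e : comp_part p (star_part p) = p.
  by rewrite (projective_star pp) (projective_comp pp).
exists p; split; [exact: Proj_cat pC | exact: e |].
by rewrite (projective_star pp) (projective_comp pp).
Qed.

Lemma part_class_eq (K : numClosedFieldType) N (G : cmqg K N.+4) C k l
    (p : part k k) (q : part l l) :
  is_noncrossing_category C -> is_easy G C -> p \in Proj C k -> q \in Proj C l ->
  part_class C p = part_class C q <-> equiv_rep (u_part G C p) (u_part G C q).
Proof.
move=> nc ez pC qC; rewrite -(u_part_equiv nc ez pC qC).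
split=> [e|/(u_part_equiv nc ez pC qC) pq].
  have : part_class C q (existT _ l q) by split; last exact: equiv_part_refl.
  by rewrite -e => -[].
apply/seteqP; split=> -[m s] [/= sC].
  move/(u_part_equiv nc ez pC sC) => ps; split=> //=.
  apply/(u_part_equiv nc ez qC sC); exact: equiv_rep_trans (equiv_rep_sym pq) ps.
move/(u_part_equiv nc ez qC sC) => qs; split=> //=.
apply/(u_part_equiv nc ez pC sC); exact: equiv_rep_trans pq qs.
Qed.

Lemma rep_class_eq (K : numClosedFieldType) N (G : cmqg K N) m n
    (v : 'M[coord G]_m) (w : 'M[coord G]_n) :
  rep_class v = rep_class w <-> equiv_rep v w.
Proof.
split=> [e|vw].
  have : rep_class w (existT _ n w) by apply: equiv_rep_refl.
  by rewrite -e.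
apply/seteqP; split=> -[k x] /= h; last exact: equiv_rep_trans vw h.
exact: equiv_rep_trans (equiv_rep_sym vw) h.
Qed.

Theorem theorem5p5 (R : realType) (N : nat) (C : part_family)
    (G : cmqg R[i]%C N) :
  (4 <= N)%N -> is_noncrossing_category C -> is_easy G C ->
  (forall k (p : part k k), p \in Proj C k ->
     u_dim G C p <> 0%N /\ irreducible_rep (u_part G C p)) /\
  (exists f : set any_part -> set (any_rep G),
     set_bij (Proj_classes C) (Irr (G := G)) f /\
     forall k (p : part k k), p \in Proj C k ->
       f (part_class C p) = rep_class (u_part G C p)).
Proof.
case: N G => [|[|[|[|N]]]] G // _ nc ez.
have irr k (p : part k k) := @u_part_irreducible _ _ G C k p nc ez.
split; first exact: irr.
(* Taking all members of the class at once avoids choosing one of them. *)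
pose f (c : set any_part) : set (any_rep G) := fun w =>
  exists k (p : part k k),
    [/\ p \in Proj C k, c = part_class C p & rep_class (u_part G C p) w].
have fE k (p : part k k) : p \in Proj C k ->
    f (part_class C p) = rep_class (u_part G C p).
  move=> pC; apply/seteqP; split=> w; last by exists k, p.
  case=> l [q [qC /(part_class_eq nc ez pC qC)/rep_class_eq e]].
  by rewrite e.
exists f; split; last exact: fE.
split.
- move=> _ [k [p [pC ->]]]; rewrite fE //.
  by exists (u_dim G C p), (u_part G C p); split=> //; case: (irr k p pC).
- move=> _ _ /set_mem[k [p [pC ->]]] /set_mem[l [q [qC ->]]].
  rewrite !fE // => /rep_class_eq e.
  exact/(part_class_eq nc ez pC qC).
move=> _ [n [v [irrv ->]]]; have [rv n0 _] := irrv.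
have [k [T [HT nzT]]] := rep_Hom_fund_pow rv n0.
have [p pC e] := irreducible_is_u_part nc ez irrv HT nzT.
exists (part_class C p); first by exists k, p.
by rewrite fE //; apply/esym/rep_class_eq.
Qed.
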